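(* Let $(M,g)$ be an (oriented) two-dimensional Riemannian manifold. For every smooth function $u$ on the unit circle bundle $\Omega(M)$, $$H\mathcal{H}u-\mathcal{H}Hu=\mathcal{H}_\perp u_0+(\mathcal{H}_\perp u)_0,$$ where $H$ is the fibrewise Hilbert transform, $\mathcal H$ is the geodesic vector field, $\mathcal{H}_\perp=(\xi_\perp,\nabla)$, and for a function $v$ on $\Omega(M)$, $v_0(x)=\frac1{2\pi}\int_{\Omega_x}v(x,\xi)\,d\Omega_x(\xi)$ is its fibre average (functions on $M$ are regarded as functions on $\Omega(M)$ not depending on $\xi$).
   Context: $\Omega_x=\{\xi\in T_xM:|\xi|_g=1\}$ with its standard measure $d\Omega_x$ induced by $g_x$ (total mass $2\pi$), and $\Omega(M)=\bigcup_{x\in M}\Omega_x$. For $\xi\in T_xM$, $\xi_\perp$ is the rotation of $\xi$ by $90^\circ$ given in (oriented) local coordinates by $(\xi_\perp)_i=\varepsilon_{ij}\xi^j$, $\varepsilon=\sqrt{\det g}\begin{pmatrix}0&1\\-1&0\end{pmatrix}$ (indices are raised and lowered with $g$). The Hilbert transform of a function $u$ on $\Omega(M)$ is the principal value integral $$Hu(x,\xi)=\frac1{2\pi}\,\mathrm{p.v.}\!\int_{\Omega_x}\frac{1+(\xi,\eta)}{(\xi_\perp,\eta)}\,u(x,\eta)\,d\Omega_x(\eta),\qquad \xi\in\Omega_x .$$ The horizontal derivative $\nabla$ of a function $u$ on $\Omega(M)$ is the covector $\nabla_ju=\left(\frac{\partial}{\partial x^j}-\Gamma^i_{jk}(x)\xi^k\frac{\partial}{\partial\xi^i}\right)\tilde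 u$ restricted to $\Omega(M)$, where $\tilde u$ is any smooth extension of $u$ to a neighbourhood of $\Omega(M)$ in $TM$ (e.g. $\tilde u(x,\xi)=u(x,\xi/|\xi|)$) and $\Gamma^i_{jk}$ are the Christoffel symbols; for a function on $M$ it is the usual differential. The geodesic vector field is $\mathcal H u=\frac{d}{dt}\big|_{t=0}u\circ\varphi_t=\xi^j\nabla_ju$, with $\varphi_t$ the geodesic flow, and $\mathcal H_\perp u=(\xi_\perp)^j\nabla_ju$. *)

(* Defs.v *)
From HB Require Import structures.
From mathcomp Require Import all_boot all_order all_algebra.
From mathcomp Require Import all_classical all_reals all_analysis.
Import Order.TTheory GRing.Theory Num.Theory.
Import numFieldNormedType.Exports.

Set Implicit Arguments.
Unset Strict Implicit.
Unset Printing Implicit Defensive.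

Local Open Scope classical_set_scope.
Local Open Scope ring_scope.

(* C^oo on D: all iterated directional derivatives exist and are
   differentiable at the points of D. Meant for open D only. *)
Definition smooth_on (R : realType) (V W : normedModType R) (D : set V)
    (f : V -> W) : Prop :=
  forall (vs : seq V) (p : V), D p ->
    differentiable (foldr (fun v h => 'D_v h) f vs) p.

(* Oriented smooth surfaces without boundary. The maps chart i and chart_inv i
   are total, but only their restrictions to chart_dom i and to its image
   matter. Each point x carries a preferred chart chart_at x of the atlas, and T_xM is
   modelled by the components of tangent vectors in that chart. *)
Record oriented_surface (R : realType) := OrientedSurface {
  carrier :> topologicalType;
  atlas : Type;
  chart_dom : atlas -> set carrier;
  chart : atlas -> carrier -> 'rV[R]_2;
  chart_inv : atlas -> 'rV[R]_2 -> carrier;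
  chart_at : carrier -> atlas;
  surface_hausdorff : hausdorff_space carrier;
  surface_second_countable : @second_countable carrier;
  chart_at_dom : forall x, chart_dom (chart_at x) x;
  dom_open : forall i, open (chart_dom i);
  img_open : forall i, open (chart i @` chart_dom i);
  chartK : forall i x, chart_dom i x -> chart_inv i (chart i x) = x;
  chart_continuous : forall i x, chart_dom i x -> {for x, continuous (chart i)};
  chart_inv_continuous : forall i y, (chart i @` chart_dom i) y ->
    {for y, continuous (chart_inv i)};
  transition_smooth : forall i j,
    smooth_on (chart i @` (chart_dom i `&` chart_dom j))
      (chart j \o chart_inv i);
  transition_oriented : forall i j y,
    (chart i @` (chart_dom i `&` chart_dom j)) y ->
    0 < \det ('J (chart j \o chart_inv i) y)
}.

Section Surface.
Variables (R : realType) (M : oriented_surface R).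

Definition chart_img (i : atlas M) : set 'rV[R]_2 := chart i @` chart_dom i.

(* The vector of T_xM, x = chart_inv i y, whose components in the chart i
   are w. *)
Definition tangent_of (i : atlas M) (y w : 'rV[R]_2) : 'rV[R]_2 :=
  'd (chart (chart_at (chart_inv i y)) \o chart_inv i) y w.

Definition riem_inner (g : M -> 'M[R]_2) (x : M) (v w : 'rV[R]_2) : R :=
  (v *m g x *m w^T) 0 0.

(* g_jk in the chart i, as functions of the coordinates y *)
Definition metric_coef (g : M -> 'M[R]_2) (i : atlas M) (y : 'rV[R]_2) :
    'M[R]_2 :=
  \matrix_(j, k) riem_inner g (chart_inv i y)
    (tangent_of i y (delta_mx 0 j)) (tangent_of i y (delta_mx 0 k)).

End Surface.

Record riemannian_metric (R : realType) (M : oriented_surface R) :=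
  RiemannianMetric {
  gram :> M -> 'M[R]_2;
  gram_sym : forall x, (gram x)^T = gram x;
  gram_pos : forall x v, v != 0 -> 0 < riem_inner gram x v v;
  gram_smooth : forall i, smooth_on (@chart_img R M i) (metric_coef gram i)
}.

Section UnitCircleBundle.
Variables (R : realType) (M : oriented_surface R) (g : riemannian_metric M).
Implicit Types (x : M) (xi eta : 'rV[R]_2).

Definition riem_norm x xi : R := Num.sqrt (riem_inner g x xi xi).

(* A function on Omega(M) is represented by a function u on TM; all notions
   below only involve the values u x xi with riem_norm x xi = 1. *)
Definition bundle_fun := M -> 'rV[R]_2 -> R.

(* The extension u(x, xi / |xi|), expressed in the chart i. *)
Definition local_ext (u : bundle_fun) (i : atlas M)
    (p : 'rV[R]_2 * 'rV[R]_2) : R :=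
  let x := chart_inv i p.1 in
  let xi := tangent_of i p.1 p.2 in
  u x ((riem_norm x xi)^-1 *: xi).

Definition smooth_bundle_fun (u : bundle_fun) : Prop :=
  forall i, smooth_on [set p | chart_img i p.1 /\ p.2 != 0] (local_ext u i).

(* (xi_perp)^k = g^ki eps_ij xi^j *)
Definition perp x xi : 'rV[R]_2 :=
  let eps : 'M[R]_2 := Num.sqrt (\det (g x)) *:
    (delta_mx ord0 ord_max - delta_mx ord_max ord0) in
  \row_k \sum_i \sum_j invmx (g x) k i * eps i j * xi 0 j.

(* Arc length parametrization of Omega_x by the angle from the first
   coordinate vector. *)
Definition circle_pt x (t : R) : 'rV[R]_2 :=
  let d1 : 'rV[R]_2 := delta_mx 0 ord0 in
  let e1 := (riem_norm x d1)^-1 *: d1 in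
  cos t *: e1 + sin t *: perp x e1.

Definition circle_integral x (A : set 'rV[R]_2) (f : 'rV[R]_2 -> R) : R :=
  Rintegral (@lebesgue_measure R) (`[0, 2 * pi]%classic `&` circle_pt x @^-1` A)
    (f \o circle_pt x).

Definition fibre_average (u : bundle_fun) : M -> R :=
  fun x => (2 * pi)^-1 * circle_integral x setT (u x).

(* The kernel is bounded near eta = - xi, so that the principal value concerns
   eta = xi only. *)
Definition hilbert (u : bundle_fun) : bundle_fun := fun x xi =>
  (2 * pi)^-1 *
  lim (circle_integral x [set eta | e < riem_norm x (eta - xi)]
         (fun eta =>
            (1 + riem_inner g x xi eta) / riem_inner g x (perp x xi) eta
            * u x eta) @[e --> 0^'+]).

(* Gamma^i_jk at the point y of the chart c *)
Definition christoffel (c : atlas M) (y : 'rV[R]_2) (i j k : 'I_2) : R :=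
  let dg (l a b : 'I_2) : R :=
    'D_(delta_mx 0 l) (fun z => metric_coef g c z a b) y in
  2^-1 * \sum_l invmx (metric_coef g c y) i l
                * (dg j l k + dg k l j - dg l j k).

Definition nabla (u : bundle_fun) x xi (j : 'I_2) : R :=
  let c := chart_at x in
  let y := chart c x in
  'D_(delta_mx 0 j, 0) (local_ext u c) (y, xi)
  - \sum_i \sum_k christoffel c y i j k * xi 0 k
      * 'D_(0, delta_mx 0 i) (local_ext u c) (y, xi).

Definition geodesic_field (u : bundle_fun) : bundle_fun := fun x xi =>
  \sum_j xi 0 j * nabla u x xi j.

Definition geodesic_field_perp (u : bundle_fun) : bundle_fun := fun x xi =>
  \sum_j perp x xi 0 j * nabla u x xi j.

Definition pullback (f : M -> R) : bundle_fun := fun x _ => f x.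

End UnitCircleBundle.

(* Main.v *)
Require Import Defs.
From mathcomp Require Import all_boot all_order all_algebra.
From mathcomp Require Import all_classical all_reals all_analysis.
From mathcomp Require Import measurable_realfun ring lra.
Import Order.TTheory GRing.Theory Num.Theory.
Import numFieldNormedType.Exports.
Set Implicit Arguments.
Unset Strict Implicit.
Unset Printing Implicit Defensive.
Local Open Scope classical_set_scope.
Local Open Scope ring_scope.

(** Fix x and a unit vector xi at x. Let xi_t denote xi turned by the angle t
    towards xi_perp. Along the fibre, with f t = v (x, xi_t), the kernel of the
    Hilbert transform is cot (t / 2), which is odd and 2 pi periodic; folding t
    and - t together gives
    - H v (x, xi) = (2 pi)^-1 int_0^pi cot (t / 2) (f t - f (- t)) dt,
    - v_0 (x)     = (2 pi)^-1 int_0^pi (f t + f (- t)) dt,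
    both absolutely convergent (hilbertE, fibre_averageE). Only rotations of xi
    enter, and these make sense in every chart, through the Gram matrix of the
    metric there. So at the points y near x, in the preferred chart of x, Hu and
    u_0 are the same integrals of the homogeneous extension of u over the
    rotations R_t w of a coordinate vector w (local_ext_hilbert,
    local_ext_average).

    These formulas can be differentiated in (y, w) under the integral sign: the
    mixed derivative of u (y, R_t w) in t and in (y, w) is bounded, so the
    derivative of f t - f (- t) is O(t), which the kernel tolerates
    (is_derive_odd_transform). The Levi-Civita connection makes the quarter turn
    J parallel (levi_civita_rot90), hence rotations carry horizontal vectors to
    horizontal vectors (nabla_rot_by). Writing N_j t for nabla_j u (x, xi_t),
    one gets nabla_j (H u) and nabla_j u_0 at xi as the two integrals above with
    f = N_j (nabla_hilbert, nabla_average): nabla commutes with both operators.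

    The geodesic field differentiates along xi_t = cos t xi + sin t xi_perp, so
    H (geodesic u) - geodesic (H u) comes only from commuting the kernel with
    the factors cos t and sin t. Since cot (t / 2) (cos t - 1) = - sin t and
    cot (t / 2) sin t = 1 + cos t, the singularity cancels: the sine and cosine
    terms assemble into the average of the derivative along (xi_t)_perp, and the
    constant 1 gives the derivative of the average along xi_perp
    (odd_transform_commutator). *)

(** * Integrals of bounded periodic functions *)

Section BoundedMeasurable.
Variable R : realType.
Local Notation mu := (@lebesgue_measure R).

(** The truncated kernels of the principal value are discontinuous, so the
    changes of variable are done in this class. *)
Definition bounded_measurable (h : R -> R) :=
  measurable_fun [set: R] h /\ exists C, forall t, `|h t| <= C.

Lemma bounded_measurable_integrable h a b : bounded_measurable h ->
  mu.-integrable `[a, b] (EFin \o h).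
Proof.
move=> [mh [C hC]]; apply: measurable_bounded_integrable => //.
- rewrite /= lebesgue_measure_itv/=; case: ifP => _; rewrite ?ltry// -EFinD ltry//.
- exact: measurable_funTS.
- exists C; split; first exact: num_real.
  by move=> x Cx t _ /=; rewrite (le_trans (hC t))// ltW.
Qed.

Lemma bounded_measurable_comp h (k : R -> R) : continuous k ->
  bounded_measurable h -> bounded_measurable (fun t => h (k t)).
Proof.
move=> ck [mh [C hC]]; split; last by exists C => t; exact: hC.
by apply: measurableT_comp => //; exact: continuous_measurable_fun.
Qed.

(** Reflections generate the translations: both changes of variable on the
    circle follow from this invariance. *)
Lemma lebesgue_measure_reflect (c : R) (A : set R) : measurable A ->
  pushforward mu ((fun t => c - t) : _ -> measurableTypeR R) A = mu A.
Proof.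
move=> mA; have mf : measurable_fun [set: R] (fun t : R => c - t).
  by apply: measurable_funB.
apply/esym.
apply: (@lebesgue_measure_unique R
  (pushforward mu ((fun t => c - t) : _ -> measurableTypeR R))) => //.
move=> _ [[a b] _ <-]; rewrite /pushforward /=.
rewrite [X in _ = lebesgue_measure X](_ : _ = `[c - b, c - a[%classic); last first.
  by apply/seteqP; split=> t /=; rewrite !in_itv/=; lra.
rewrite !lebesgue_measure_itv/= !lte_fin.
by rewrite ltrD2l ltrN2; case: ifP => // _; rewrite -!EFinD; congr EFin; ring.
Qed.

Lemma Rintegral_reflect h a b c : bounded_measurable h ->
  Rintegral mu `[a, b] (fun t => h (c - t)) = Rintegral mu `[c - b, c - a] h.
Proof.
move=> bh; rewrite /Rintegral; congr fine.
have mf : measurable_fun [set: R] (fun t : R => c - t).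
  by apply: measurable_funB.
have E : (fun t => c - t) @^-1` `[c - b, c - a] = `[a, b]%classic :> set R.
  by apply/seteqP; split=> t /=; rewrite !in_itv/=; lra.
rewrite -[in LHS]E.
have -> : (\int[mu]_(t in `[(c - b)%R, (c - a)%R]) (h t)%:E =
   \int[pushforward mu ((fun t => (c - t)%R) : _ -> measurableTypeR R)]_(t in `[(c -
     b)%R, (c - a)%R]) (h t)%:E)%E.
  by apply: eq_measure_integral => A mA _; exact/esym/lebesgue_measure_reflect.
transitivity (\int[mu]_(t in ((fun t =>
  (c - t)%R) : measurableTypeR R -> measurableTypeR R) @^-1` `[(c - b)%R, (c - a)%R])
  ((EFin \o h) \o (fun t => (c - t)%R)) t)%E => //.
apply/esym; apply: (@integral_pushforward _ _ (measurableTypeR R)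
  (measurableTypeR R) R _ mf mu `[c - b, c - a] (EFin \o h)) => //=.
- by apply/measurable_EFinP; case: bh.
- rewrite E; apply: bounded_measurable_integrable.
  apply: (@bounded_measurable_comp h (fun t => c - t)) => //.
  by move=> t; apply: cvgB; [exact: cvg_cst|exact: cvg_id].
Qed.

Lemma Rintegral_shift h a b c : bounded_measurable h ->
  Rintegral mu `[a, b] (fun t => h (t + c)) = Rintegral mu `[a + c, b + c] h.
Proof.
move=> bh; have bk : bounded_measurable (fun t => h (c - t)).
  apply: (@bounded_measurable_comp h (fun t => c - t)) => //.
  by move=> t; apply: cvgB; [exact: cvg_cst|exact: cvg_id].
transitivity (Rintegral mu `[a, b] (fun t => h (c - (0 - t)))).
  by apply: eq_Rintegral => t _; congr h; ring.
rewrite (Rintegral_reflect _ _ 0 bk) Rintegral_reflect//.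
by have [-> ->] : c - (0 - a) = a + c /\ c - (0 - b) = b + c by split; ring.
Qed.

Lemma Rintegral_split h a b c : bounded_measurable h -> a <= b -> b <= c ->
  Rintegral mu `[a, c] h = Rintegral mu `[a, b] h + Rintegral mu `[b, c] h.
Proof.
move=> bh ab bc.
have := @Rintegral_itvB R h (BLeft a) (BRight c) b (bounded_measurable_integrable a c bh).
rewrite !bnd_simp => /(_ ab bc).
rewrite Rintegral_itv_obnd_cbnd; first by move=> <-; ring.
by apply: integrableS (bounded_measurable_integrable b c bh) => //;
  exact: subset_itv_oc_cc.
Qed.

(** The part of [s, p + s] beyond p is the part of [0, p] before s, shifted
    by one period. *)
Lemma Rintegral_periodic h (p s : R) : bounded_measurable h ->
  (forall t, h (t + p) = h t) -> 0 <= s <= p ->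
  Rintegral mu `[0, p] (fun t => h (t + s)) = Rintegral mu `[0, p] h.
Proof.
move=> bh hp /andP[s0 sp]; rewrite Rintegral_shift// add0r.
rewrite (@Rintegral_split h s p (p + s))//; last by rewrite lerDl.
rewrite (@Rintegral_split h 0 s p)// addrC; congr (_ + _).
have <- : Rintegral mu `[0, s] (fun t => h (t + p)) = Rintegral mu `[0, s] h.
  by apply: eq_Rintegral => t _; rewrite hp.
by rewrite Rintegral_shift// add0r (addrC s).
Qed.

(** Modulo the period, the reflection t |-> 2 p - t of the second half is
    t |-> - t. *)
Lemma Rintegral_fold h (p : R) : bounded_measurable h -> 0 <= p ->
  (forall t, h (t + 2 * p) = h t) ->
  Rintegral mu `[0, 2 * p] h = Rintegral mu `[0, p] (fun t => h t + h (- t)).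
Proof.
move=> bh p0 hp.
have bk : bounded_measurable (fun t => h (- t)).
  by apply: (@bounded_measurable_comp h) => //; exact: opp_continuous.
rewrite (RintegralD _ (bounded_measurable_integrable _ _ bh)
   (bounded_measurable_integrable _ _ bk))//.
rewrite (@Rintegral_split h 0 p)//; last by lra.
congr (_ + _).
transitivity (Rintegral mu `[0, p] (fun t => h (2 * p - t))).
  rewrite (Rintegral_reflect _ _ _ bh).
  by have [-> ->] : 2 * p - p = p /\ 2 * p - 0 = 2 * p by split; ring.
by apply: eq_Rintegral => t _; rewrite -[in RHS]hp; congr h; ring.
Qed.

(** Inversion is continuous off the closed set {0}, on which it is constant. *)
Lemma measurable_funV (f : R -> R) : measurable_fun [set: R] f ->
  measurable_fun [set: R] (fun t => (f t)^-1).
Proof.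
move=> mf; apply: (@measurableT_comp _ _ _ _ _ _ (fun x : R => x^-1)) => //.
have -> : [set: R] = [set 0] `|` ~` [set 0] by rewrite setUv.
apply/measurable_funU => //; first exact: measurableC.
split; first exact: measurable_fun_set1.
apply: open_continuous_measurable_fun.
  by apply: closed_openC; exact/accessible_closed_set1/hausdorff_accessible/Rhausdorff.
by move=> x; rewrite inE => /= /eqP x0; exact: inv_continuous.
Qed.

End BoundedMeasurable.

(** * The kernel cot (t / 2) and its principal value *)

Section CircleKernel.
Variable R : realType.
Local Notation mu := (@lebesgue_measure R).
Implicit Types (f : R -> R) (t s e : R).

Definition half_cot t : R := cos (t / 2) / sin (t / 2).

(** Half-angle formulas. With x / 0 = 0 both sides also vanish together where
    sin t = 0, so the identity holds for every t. *)
Lemma half_cot_cos_sin t : (1 + cos t) / sin t = half_cot t.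
Proof.
have E : t = t / 2 + t / 2 by field.
rewrite /half_cot {1 2}E cosD sinD.
have := cos2Dsin2 (t / 2).
set c := cos (t / 2); set s := sin (t / 2) => cs.
have -> : 1 + (c * c - s * s) = 2 * c * c by lra.
have [->|c0] := eqVneq c 0; first by rewrite !(mulr0, mul0r).
have [->|s0] := eqVneq s 0; first by rewrite !(mulr0, mul0r, add0r, invr0).
have -> : s * c + c * s = 2 * (c * s) by ring.
by field; rewrite s0 c0.
Qed.

Lemma half_cotN t : half_cot (- t) = - half_cot t.
Proof. by rewrite /half_cot mulNr cosN sinN invrN mulrN. Qed.

Lemma half_cot_periodic t : half_cot (t + 2 * pi) = half_cot t.
Proof.
rewrite /half_cot; have -> : (t + 2 * pi) / 2 = t / 2 + pi by field.
by rewrite sinDpi cosDpi invrN mulrNN.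
Qed.

(** Here x cos x <= sin x for x = t / 2, by the mean value theorem for sin
    and because cos decreases: one factor t absorbs the singularity. *)
Lemma half_cot_bound t : 0 <= t <= pi -> `|half_cot t| * t <= 2.
Proof.
move=> /andP[]; rewrite le_eqVlt => /predU1P[<- _|t0 tpi].
  by rewrite mulr0.
have tpi2 : 0 < t / 2 <= pi / 2 by apply/andP; split; lra.
have := tpi2 => /andP[h0 h1].
have s0 : 0 < sin (t / 2).
  by apply: sin_gt0_pi; have := pi_gt0 R; lra.
have c0 : 0 <= cos (t / 2) by apply: cos_ge0_pihalf; lra.
rewrite /half_cot ger0_norm; last by rewrite divr_ge0// ltW.
rewrite mulrAC ler_pdivrMr//.
have [|c cI] := @MVT R sin cos 0 (t / 2) h0 (fun x _ => is_derive_sin x).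
  by apply: continuous_subspaceT; exact: continuous_sin.
rewrite sin0 !subr0 => ->; move: cI; rewrite in_itv/= => /andP[c1 c2].
have cc : cos (t / 2) <= cos c.
  by rewrite ltW// ltr_cos// in_itv/=; have := pi_gt0 R; lra.
by have := ler_wpM2r (ltW h0) cc; lra.
Qed.

Lemma measurable_half_cot : measurable_fun [set: R] half_cot.
Proof.
have mh : measurable_fun [set: R] (fun t : R => t / 2).
  by apply: continuous_measurable_fun => x; apply: cvgM; [exact: cvg_id|exact: cvg_cst].
apply: measurable_funM.
- by apply: (@measurableT_comp _ _ _ _ _ _ (@cos R)) => //;
  exact: continuous_measurable_fun (@continuous_cos R).
- apply: measurable_funV.
  by apply: (@measurableT_comp _ _ _ _ _ _ (@sin R)) => //;
    exact: continuous_measurable_fun (@continuous_sin R).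
Qed.

(** The chord between the points of angles 0 and t has length 2 |sin (t / 2)|. *)
Definition far_set e : set R := [set t | e < 2 * `|sin (t / 2)|].

Lemma far_setN e t : (- t \in far_set e) = (t \in far_set e).
Proof. by apply: asbool_equiv_eq; rewrite /far_set/= mulNr sinN normrN. Qed.

Lemma far_set_periodic e t :
  (t + 2 * pi \in far_set e) = (t \in far_set e).
Proof.
apply: asbool_equiv_eq; rewrite /far_set/=;
  have -> : (t + 2 * pi) / 2 = t / 2 + pi by field.
by rewrite sinDpi normrN.
Qed.

Lemma measurable_far_set e : measurable (far_set e).
Proof.
apply: open_measurable; rewrite /far_set.
have -> : [set t | e < 2 * `|sin (t / 2)|] =
    (fun t : R => 2 * `|sin (t / 2)|) @^-1` [set x | e < x] by [].
apply: open_comp; last exact: open_gt.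
move=> t _; apply: cvgM; first exact: cvg_cst.
apply: cvg_norm; apply: continuous_comp; last exact: continuous_sin.
by apply: cvgM; [exact: cvg_id|exact: cvg_cst].
Qed.

Lemma periodic_continuous_bounded f (p : R) : 0 < p -> continuous f ->
  (forall t, f (t + p) = f t) -> exists C, forall t, `|f t| <= C.
Proof.
move=> p0 cf fp.
have fn (n : nat) t : f (t + p *+ n) = f t.
  by elim: n t => [|n IH] t; rewrite ?mulr0n ?addr0// mulrS addrA IH fp.
have fz (n : int) t : f (t + p *~ n) = f t.
  case: n => n; first by rewrite -pmulrn fn.
  by rewrite NegzE mulrNz -[LHS](fn n.+1) -pmulrn subrK.
have : compact (f @` `[0, p]).
  apply: continuous_compact; last exact: segment_compact.
  exact: continuous_subspaceT.
move=> /compact_bounded [M [_ hM]].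
exists (M + 1) => t; have /hM h : M < M + 1 by rewrite ltrDl.
rewrite -[f t](fz (- Num.floor (t / p))); apply: h => /=.
exists (t + p *~ - Num.floor (t / p)) => //; rewrite /= in_itv/=.
have /andP[h1 h2] := floor_itv (t / p).
rewrite mulrNz -[p *~ _]mulrzl subr_ge0 lerBlDr.
rewrite -ler_pdivlMr// h1/=.
have := ltW h2; rewrite ler_pdivrMr// rmorphD/= mulrDl mul1r; lra.
Qed.

(** The odd kernel sees only the odd part of f; bounding it by a multiple of t
    is what makes the principal value converge. *)
Definition circle_lipschitz f := [/\ continuous f,
  forall t, f (t + 2 * pi) = f t &
  exists C, forall t, 0 <= t <= pi -> `|f t - f (- t)| <= C * t].

(** The principal value over the circle of cot (t / 2) f t, with t and - t
    folded together. *)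
Definition odd_transform f : R :=
  Rintegral mu `[0, pi] (fun t => half_cot t * (f t - f (- t))).

(** The integral over the circle, folded in the same way, so that it can be
    compared with odd_transform under one integral sign. *)
Definition circle_sum f : R := Rintegral mu `[0, pi] (fun t => f t + f (- t)).

Section PrincipalValue.
Variable f : R -> R.
Hypothesis f_continuous : continuous f.
Hypothesis f_periodic : forall t, f (t + 2 * pi) = f t.

Let f_bm : bounded_measurable f.
Proof.
split; first exact: continuous_measurable_fun.
apply: (@periodic_continuous_bounded f (2 * pi)) => //.
by have := pi_gt0 R; lra.
Qed.

Lemma circle_sumE s : 0 <= s <= 2 * pi ->
  Rintegral mu `[0, 2 * pi] (fun t => f (t + s)) =
  circle_sum f.
Proof. by move=> s0; rewrite Rintegral_periodic// Rintegral_fold// pi_ge0. Qed.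

Let trunc e := (fun t => half_cot t * f t) \_ (far_set e).

Let trunc_bm e : 0 < e -> bounded_measurable (trunc e).
Proof.
move=> e0; have [mf [C fC]] := f_bm; split.
  apply/(measurable_restrictT _ (measurable_far_set e)).
  by apply: measurable_funTS; apply: measurable_funM => //; exact: measurable_half_cot.
have C0 : 0 <= C by rewrite (le_trans _ (fC 0)).
exists (2 / e * C) => t; rewrite /trunc patchE; case: ifPn => [/set_mem ft|_].
  rewrite normrM ler_pM// /half_cot normrM normfV.
  rewrite ler_pdivrMr; last by rewrite /far_set/= in ft; lra.
  have := cos_max (t / 2); rewrite mulrAC ler_pdivlMr//.
  rewrite /far_set/= in ft => c1.
  have := ler_wpM2r (ltW e0) c1; lra.
by rewrite normr0 !mulr_ge0// invr_ge0 ltW.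
Qed.

Let fold_trunc e s : 0 < e -> 0 <= s <= 2 * pi ->
  Rintegral mu `[0, 2 * pi] (fun t => trunc e (t + s)) =
  Rintegral mu `[0, pi]
    ((fun t => half_cot t * (f t - f (- t))) \_ (far_set e)).
Proof.
move=> e0 s0; have tb := trunc_bm e0.
have tp t : trunc e (t + 2 * pi) = trunc e t.
  rewrite /trunc !patchE f_periodic half_cot_periodic.
  by rewrite far_set_periodic.
rewrite Rintegral_periodic// Rintegral_fold ?pi_ge0//.
apply: eq_Rintegral => t _; rewrite /trunc !patchE half_cotN.
rewrite far_setN.
by case: ifP => _; [ring|exact: addr0].
Qed.

Hypothesis f_lipschitz : exists C, forall t, 0 <= t <= pi ->
  `|f t - f (- t)| <= C * t.

Lemma half_cot_odd_part_bounded : exists C, forall t, 0 <= t <= pi ->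
  `|half_cot t * (f t - f (- t))| <= C.
Proof.
have [C fC] := f_lipschitz; exists (C * 2) => t t0.
have C0 : 0 <= C.
  have := fC pi; rewrite pi_ge0 lexx => /(_ isT) /(le_trans (normr_ge0 _)).
  by rewrite pmulr_lge0 ?pi_gt0.
rewrite normrM; apply: (le_trans (ler_wpM2l (normr_ge0 _) (fC t t0))).
by rewrite mulrCA ler_wpM2l// half_cot_bound.
Qed.

Let mg : measurable_fun [set: R] (fun t => half_cot t * (f t - f (- t))).
Proof.
apply: measurable_funM; first exact: measurable_half_cot.
apply: measurable_funB; first by case: f_bm.
by apply: measurableT_comp => //; case: f_bm.
Qed.

Lemma half_cot_odd_part_integrable :
  mu.-integrable `[0, pi] (EFin \o (fun t => half_cot t * (f t - f (- t)))).
Proof.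
have [C gC] := half_cot_odd_part_bounded.
apply: measurable_bounded_integrable => //=.
- by rewrite lebesgue_measure_itv/=; case: ifP => _; rewrite ?ltry// -EFinD ltry.
- exact: measurable_funTS.
- exists C; split; first exact: num_real.
  move=> x Cx t; rewrite /= in_itv/= => /gC h.
  by rewrite (le_trans h)// ltW.
Qed.

(** The truncated sets are symmetric, so folding commutes with truncation; the
    folded integrands are dominated by that of odd_transform f. The shift s is
    the angle at which the parametrization of the circle starts. *)
Lemma principal_value_cvg s : 0 <= s <= 2 * pi ->
  Rintegral mu `[0, 2 * pi] (fun t =>
    ((fun r => half_cot r * f r) \_ (far_set e)) (t + s)) @[e --> 0^'+] -->
  odd_transform f.
Proof.
move=> s0; apply/cvg_at_rightP => u [u0 ucvg].
set g := fun t => half_cot t * (f t - f (- t)).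
have -> : (fun n => Rintegral mu `[0, 2 * pi] (fun t => trunc (u n) (t + s))) =
  (fun n => Rintegral mu `[0, pi] (g \_ (far_set (u n)))).
  by apply/funext => n; exact: fold_trunc.
have gi := half_cot_odd_part_integrable.
rewrite /Rintegral; apply: fine_cvg.
rewrite fineK; last exact: integrable_fin_num.
apply: (@dominated_cvg _ _ _ mu _ _
    (fun n t => ((g \_ (far_set (u n))) t)%:E) _ (fun t => `|(g t)%:E|%E)) => //=.
- move=> n; apply/measurable_EFinP; apply: measurable_funTS.
  apply/(measurable_restrictT _ (measurable_far_set (u n))).
  exact: measurable_funTS.
- move=> t; rewrite /= in_itv/= => /andP[]; rewrite le_eqVlt.
  move=> /predU1P[<- _|t0 tpi]; apply: cvg_EFin; try exact: nearW.
  (* truncation removes t = 0, where the folded integrand is 0 anyway *)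
  + apply: (@cvg_trans _ (g 0 @[_ --> \oo])); last exact: cvg_cst.
    apply: near_eq_cvg; near=> n.
    by rewrite /= patchE; case: ifP => // _; rewrite /g oppr0 subrr mulr0.
  + have st : 0 < sin (t / 2) by apply: sin_gt0_pi; have := pi_gt0 R; lra.
    apply: (@cvg_trans _ (g t @[_ --> \oo])); last exact: cvg_cst.
    apply: near_eq_cvg; near=> n.
    rewrite /= patchE ifT//; apply/mem_set; rewrite /far_set/=.
    near: n; apply: (cvgr_lt 0 ucvg); rewrite gtr0_norm//; lra.
- exact: integrable_norm.
- move=> n t _; rewrite lee_fin patchE; case: ifP => // _.
  by rewrite normr0.
Unshelve. all: by end_near. Qed.

End PrincipalValue.
End CircleKernel.

(** * Rotations of an oriented plane given by its Gram matrix *)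

Section PlaneAlgebra.
Variable R : realType.
Implicit Types (G T : 'M[R]_2) (v w : 'rV[R]_2).

Lemma ord2P (P : 'I_2 -> Prop) : P ord0 -> P ord_max -> forall i, P i.
Proof.
move=> P0 P1 i; have [/eqP->//|i0] := boolP (i == ord0).
suff -> : i = ord_max by [].
by apply: val_inj; case: i i0 => -[|[|]].
Qed.

Lemma sum_ord2 (V : nmodType) (F : 'I_2 -> V) :
  \sum_i F i = F ord0 + F ord_max.
Proof.
rewrite big_ord_recl big_ord1; congr (_ + F _); exact: val_inj.
Qed.

Lemma row2_eq v w : v 0 ord0 = w 0 ord0 -> v 0 ord_max = w 0 ord_max -> v = w.
Proof. by move=> h0 h1; apply/rowP; exact: ord2P. Qed.

Definition gram_inner G v w : R := (v *m G *m w^T) 0 0.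

Lemma gram_innerE G v w : gram_inner G v w =
  G ord0 ord0 * v 0 ord0 * w 0 ord0 + G ord0 ord_max * v 0 ord0 * w 0 ord_max
  + G ord_max ord0 * v 0 ord_max * w 0 ord0
  + G ord_max ord_max * v 0 ord_max * w 0 ord_max.
Proof. by rewrite /gram_inner !mxE sum_ord2 !mxE !sum_ord2; ring. Qed.

Lemma det2E G : \det G =
  G ord0 ord0 * G ord_max ord_max - G ord0 ord_max * G ord_max ord0.
Proof.
rewrite (expand_det_row G ord0) sum_ord2 /cofactor !det_mx11 !mxE /=.
rewrite add0n expr0 expr1 !mul1r mulN1r mulrN; congr (_ * G _ _ - _ * G _ _);
  exact: val_inj.
Qed.

Lemma invmx2E G : \det G != 0 ->
  [/\ invmx G ord0 ord0 = G ord_max ord_max / \det G,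
      invmx G ord0 ord_max = - G ord0 ord_max / \det G,
      invmx G ord_max ord0 = - G ord_max ord0 / \det G &
      invmx G ord_max ord_max = G ord0 ord0 / \det G].
Proof.
move=> d0; have uG : G \in unitmx by rewrite unitmxE unitfE.
pose B : 'M[R]_2 := \matrix_(i, j) ((if i == j then
  (if i == ord0 then G ord_max ord_max else G ord0 ord0) else - G i j) / \det G).
have GB : G *m B = 1%:M.
  by apply/matrixP; apply: ord2P; apply: ord2P;
    rewrite !mxE sum_ord2 !mxE /=; move: d0; rewrite det2E => d0; field.
have -> : invmx G = B by rewrite -[LHS]mulmx1 -GB mulmxA mulVmx// mul1mx.
by split; rewrite mxE.
Qed.

(** This is perp at the Gram matrix G; in a chart it is applied to the matrix
    of metric coefficients. *)
Definition rot90 G v : 'rV[R]_2 :=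
  let eps : 'M[R]_2 := Num.sqrt (\det G) *:
    (delta_mx ord0 ord_max - delta_mx ord_max ord0) in
  \row_k \sum_i \sum_j invmx G k i * eps i j * v 0 j.

Definition rot_by G (t : R) v := cos t *: v + sin t *: rot90 G v.

Definition spd G := G^T = G /\ forall v, v != 0 -> 0 < gram_inner G v v.

(** In terms of the area element s the matrix G and the map rot90 G are
    rational, which turns the identities below into field equations. *)
Lemma spd_param G : spd G -> exists a b s, [/\ 0 < a, 0 < s,
  [/\ G ord0 ord0 = a, G ord0 ord_max = b, G ord_max ord0 = b &
   G ord_max ord_max = (s ^+ 2 + b ^+ 2) / a] & 
  \det G = s ^+ 2].
Proof.
move=> [Gs Gp]; set a := G ord0 ord0; set b := G ord0 ord_max.
have Gb : G ord_max ord0 = b by rewrite -Gs mxE.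
have a0 : 0 < a.
  have /Gp : delta_mx 0 ord0 != 0 :> 'rV[R]_2.
    by apply/eqP => /matrixP /(_ 0 ord0); rewrite !mxE /=; apply/eqP/oner_neq0.
  by rewrite gram_innerE !mxE /= -/a !(mulr0, mulr1, addr0).
have d0 : 0 < \det G.
  have /Gp : \row_(j < 2) (if j == ord0 then - b else a) != 0 :> 'rV[R]_2.
    by apply/eqP => /matrixP /(_ 0 ord_max); rewrite !mxE /=; apply/eqP/lt0r_neq0.
  rewrite gram_innerE !mxE /= Gb -/a -/b.
  have -> : a * - b * - b + b * - b * a + b * a * - b + G ord_max ord_max * a * a
     = a * \det G by rewrite det2E Gb -/a -/b; ring.
  by rewrite pmulr_rgt0.
exists a, b, (Num.sqrt (\det G)); split => //.
- by rewrite sqrtr_gt0.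
- split => //; rewrite sqr_sqrtr ?ltW// det2E Gb -/a -/b.
  by field; rewrite lt0r_neq0.
- by rewrite sqr_sqrtr ?ltW.
Qed.

Lemma rot90E G : spd G -> exists a b s, [/\ 0 < a, 0 < s,
  [/\ G ord0 ord0 = a, G ord0 ord_max = b, G ord_max ord0 = b &
   G ord_max ord_max = (s ^+ 2 + b ^+ 2) / a],
  forall v, rot90 G v 0 ord0 =
    ((s ^+ 2 + b ^+ 2) / a * v 0 ord_max + b * v 0 ord0) / s &
  forall v, rot90 G v 0 ord_max = - (b * v 0 ord_max + a * v 0 ord0) / s].
Proof.
move=> /spd_param[a [b [s [a0 s0 [G00 G01 G10 G11] dG]]]].
have d0 : \det G != 0 by rewrite dG expf_neq0// lt0r_neq0.
have [i00 i01 i10 i11] := invmx2E d0.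
exists a, b, s; split => // v; rewrite /rot90 !mxE !sum_ord2 !mxE /=
  ?i00 ?i01 ?i10 ?i11 ?G00 ?G01 ?G10 ?G11 dG sqrtr_sqr gtr0_norm//.
  by field; rewrite !lt0r_neq0.
by field; rewrite !lt0r_neq0.
Qed.

Lemma rot90_linear G k v w : spd G ->
  rot90 G (k *: v + w) = k *: rot90 G v + rot90 G w.
Proof.
move=> /rot90E[a [b [s [a0 s0 _ E0 E1]]]].
by apply: row2_eq; rewrite !(E0, E1, mxE); field; rewrite !lt0r_neq0.
Qed.

Lemma rot90Z G k v : spd G -> rot90 G (k *: v) = k *: rot90 G v.
Proof.
move=> /rot90E[a [b [s [a0 s0 _ E0 E1]]]].
by apply: row2_eq; rewrite !(E0, E1, mxE); field; rewrite !lt0r_neq0.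
Qed.

Lemma rot90K G v : spd G -> rot90 G (rot90 G v) = - v.
Proof.
move=> /rot90E[a [b [s [a0 s0 _ E0 E1]]]].
by apply: row2_eq; rewrite !(E0, E1, mxE); field; rewrite !lt0r_neq0.
Qed.

Lemma gram_innerC G v w : spd G -> gram_inner G v w = gram_inner G w v.
Proof.
move=> /spd_param[a [b [s [_ _ [G00 G01 G10 G11] _]]]].
by rewrite !gram_innerE G00 G01 G10 G11; ring.
Qed.

Lemma gram_innerDr G v w1 w2 :
  gram_inner G v (w1 + w2) = gram_inner G v w1 + gram_inner G v w2.
Proof. by rewrite !gram_innerE !mxE; ring. Qed.

Lemma gram_innerZr G k v w : gram_inner G v (k *: w) = k * gram_inner G v w.
Proof. by rewrite !gram_innerE !mxE; ring. Qed.

Lemma gram_innerDl G v w1 w2 :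
  gram_inner G (w1 + w2) v = gram_inner G w1 v + gram_inner G w2 v.
Proof. by rewrite !gram_innerE !mxE; ring. Qed.

Lemma gram_innerZl G k v w : gram_inner G (k *: w) v = k * gram_inner G w v.
Proof. by rewrite !gram_innerE !mxE; ring. Qed.

Lemma gram_inner_rot90 G v w : spd G ->
  gram_inner G (rot90 G v) (rot90 G w) = gram_inner G v w.
Proof.
move=> /rot90E[a [b [s [a0 s0 [G00 G01 G10 G11] E0 E1]]]].
by rewrite !gram_innerE G00 G01 G10 G11 !(E0, E1); field; rewrite !lt0r_neq0.
Qed.

Lemma gram_inner_rot90_orth G v : spd G -> gram_inner G v (rot90 G v) = 0.
Proof.
move=> /rot90E[a [b [s [a0 s0 [G00 G01 G10 G11] E0 E1]]]].
by rewrite !gram_innerE G00 G01 G10 G11 !(E0, E1); field; rewrite !lt0r_neq0.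
Qed.

(** Expansion in the orthogonal basis v, rot90 G v, with the denominator
    cleared. *)
Lemma orth_decomposition G v w : spd G ->
  gram_inner G v v *: w =
  gram_inner G w v *: v + gram_inner G w (rot90 G v) *: rot90 G v.
Proof.
move=> /rot90E[a [b [s [a0 s0 [G00 G01 G10 G11] E0 E1]]]].
rewrite !gram_innerE G00 G01 G10 G11 !(E0, E1).
by apply: row2_eq; rewrite !(E0, E1, mxE); field; rewrite !lt0r_neq0.
Qed.

Lemma rot_byZ G k t v : spd G -> rot_by G t (k *: v) = k *: rot_by G t v.
Proof.
by move=> sG; rewrite /rot_by rot90Z// scalerDr !scalerA ![k * _]mulrC.
Qed.

Lemma rot_by0 G v : rot_by G 0 v = v.
Proof. by rewrite /rot_by cos0 sin0 scale0r addr0 scale1r. Qed.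

Lemma rot_byD G s t v : spd G -> rot_by G s (rot_by G t v) = rot_by G (t + s) v.
Proof.
move=> sG; rewrite /rot_by rot90_linear// rot90Z// rot90K// cosD sinD.
by apply/rowP => k; rewrite !mxE; ring.
Qed.

Lemma rot90_rot_by G t v : spd G ->
  rot90 G (rot_by G t v) = cos t *: rot90 G v - sin t *: v.
Proof. by move=> sG; rewrite /rot_by rot90_linear// rot90Z// rot90K// scalerN. Qed.

Lemma gram_inner_rot_by G s t v : spd G -> gram_inner G (rot_by G s v) (rot_by G t v) =
  cos (t - s) * gram_inner G v v.
Proof.
move=> sG; rewrite /rot_by !(gram_innerDl, gram_innerDr, gram_innerZl, gram_innerZr).
rewrite gram_inner_rot90// (gram_innerC (rot90 G v))// gram_inner_rot90_orth//.
by rewrite cosB; ring.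
Qed.

Lemma rot_by_periodic G t v : rot_by G (t + 2 * pi) v = rot_by G t v.
Proof. by rewrite /rot_by mulr_natl cosD2pi sinD2pi. Qed.

Lemma angle_exists (a b : R) : a ^+ 2 + b ^+ 2 = 1 ->
  exists2 s, 0 <= s <= 2 * pi & a = cos s /\ b = sin s.
Proof.
move=> ab; have ha : -1 <= a <= 1.
  rewrite -ler_norml -(@ler_sqr _ `|a|) ?nnegrE// expr1n real_normK ?num_real//.
  by have := sqr_ge0 b; lra.
have s1 : sin (acos a) = `|b|.
  by rewrite sin_acos// -sqrtr_sqr; congr Num.sqrt; lra.
have [b0|b0] := leP 0 b.
  exists (acos a); first by rewrite acos_ge0// (le_trans (acos_lepi ha))//;
    have := pi_ge0 R; lra.
  by rewrite s1 ger0_norm// acosK.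
exists (2 * pi - acos a).
  have := acos_ge0 ha; have := acos_lepi ha; lra.
rewrite cosB sinB mulr_natl cos2pi sin2pi s1 ltr0_norm// acosK//.
by split; ring.
Qed.

Lemma rot_by_exists G v w : spd G -> gram_inner G v v = 1 ->
  gram_inner G w w = 1 -> exists2 s, 0 <= s <= 2 * pi & w = rot_by G s v.
Proof.
move=> sG v1 w1; have := orth_decomposition v w sG; rewrite v1 scale1r => ew.
have := w1; rewrite {1 2}ew !(gram_innerDl, gram_innerDr, gram_innerZl, gram_innerZr).
rewrite gram_inner_rot90// (gram_innerC (rot90 G v))// gram_inner_rot90_orth//.
rewrite v1 !(mulr0, mulr1, addr0, add0r) -!expr2 => /angle_exists[s s0 [c1 c2]].
by exists s => //; rewrite ew c1 c2.
Qed.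

Lemma spd_congr G T : spd G -> \det T != 0 -> spd (T *m G *m T^T).
Proof.
move=> [Gs Gp] dT; have uT : T \in unitmx by rewrite unitmxE unitfE.
split; first by rewrite !trmx_mul trmxK Gs mulmxA.
move=> v v0; have : v *m T != 0.
  apply: contra v0 => /eqP vT.
  by rewrite -(mulmxK uT v) vT mul0mx.
by move=> /Gp; rewrite /gram_inner trmx_mul !mulmxA.
Qed.

Lemma gram_inner_congr G T v w :
  gram_inner (T *m G *m T^T) v w = gram_inner G (v *m T) (w *m T).
Proof. by rewrite /gram_inner trmx_mul !mulmxA. Qed.

(** The right-hand side is the oriented area of w and v, which a linear map
    multiplies by its determinant. *)
Lemma gram_inner_rot90_area G v w : spd G -> gram_inner G w (rot90 G v) =
  Num.sqrt (\det G) * (w 0 ord0 * v 0 ord_max - w 0 ord_max * v 0 ord0).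
Proof.
move=> sG; have [a [b [s [a0 s0 [G00 G01 G10 G11] E0 E1]]]] := rot90E sG.
have -> : Num.sqrt (\det G) = s.
  have -> : \det G = s ^+ 2.
    by rewrite det2E G00 G01 G10 G11; field; rewrite lt0r_neq0.
  by rewrite sqrtr_sqr gtr0_norm.
by rewrite !gram_innerE G00 G01 G10 G11 !(E0, E1); field; rewrite !lt0r_neq0.
Qed.

Lemma gram_inner_inj G v w : spd G ->
  (forall z, gram_inner G z v = gram_inner G z w) -> v = w.
Proof.
move=> [_ Gp] vw; apply/eqP; rewrite -subr_eq0; apply/negPn/negP => /Gp.
rewrite -[X in gram_inner G _ (v + X)]scaleN1r gram_innerDr gram_innerZr vw.
by rewrite mulN1r subrr ltxx.
Qed.

(** The two sides have the same inner products, by the area formula; the sign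
    of det T enters through the square root of its square. This is why perp
    does not depend on the oriented chart. *)
Lemma rot90_congr G T v : spd G -> 0 < \det T ->
  rot90 G (v *m T) = rot90 (T *m G *m T^T) v *m T.
Proof.
move=> sG dT; have dT0 : \det T != 0 by rewrite lt0r_neq0.
have uT : T \in unitmx by rewrite unitmxE unitfE.
apply: (gram_inner_inj sG) => z; rewrite -(mulmxKV uT z).
move: (z *m invmx T) => y.
rewrite -gram_inner_congr !gram_inner_rot90_area//; last exact: spd_congr.
rewrite !det_mulmx det_tr.
have -> : Num.sqrt (\det T * \det G * \det T) = \det T * Num.sqrt (\det G).
  by rewrite mulrAC -expr2 sqrtrM ?sqr_ge0// sqrtr_sqr gtr0_norm.
by rewrite !mxE !sum_ord2 (det2E T); ring.
Qed.

Lemma rot_by_congr G T t v : spd G -> 0 < \det T ->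
  rot_by G t (v *m T) = rot_by (T *m G *m T^T) t v *m T.
Proof. by move=> sG dT; rewrite /rot_by rot90_congr// mulmxDl -!scalemxAl. Qed.

Lemma rot_by_neq0 G t v : spd G -> v != 0 -> rot_by G t v != 0.
Proof.
move=> sG v0; apply/eqP => tv.
have := gram_inner_rot_by t t v sG; rewrite tv subrr cos0 mul1r.
rewrite {1}/gram_inner !mul0mx mxE => v00.
by have := proj2 sG _ v0; rewrite -v00 ltxx.
Qed.

End PlaneAlgebra.

(** * The operators on one fibre *)

Section FibreFormulas.
Variables (R : realType) (M : oriented_surface R) (g : riemannian_metric M).
Local Notation mu := (@lebesgue_measure R).
Implicit Types (x : M) (xi : 'rV[R]_2) (v : bundle_fun M).

Lemma spd_gram x : spd (g x).
Proof. by split; [exact: gram_sym|exact: gram_pos]. Qed.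

Lemma riem_innerE x : riem_inner g x = gram_inner (g x).
Proof. by []. Qed.

(** The fibre can be parametrized from xi instead of the normalized first
    coordinate vector, which is not continuous in x when the preferred chart
    changes. *)
Lemma circle_pt_rot x xi : riem_norm g x xi = 1 ->
  exists2 s, 0 <= s <= 2 * pi &
    forall t, circle_pt g x t = rot_by (g x) (t + s) xi.
Proof.
move=> xi1; have sG := spd_gram x.
have unit_inner w : riem_norm g x w = 1 -> gram_inner (g x) w w = 1.
  move=> w1; have := sqr_sqrtr (ltW (@ltr01 R)); rewrite -w1.
  have : 0 <= gram_inner (g x) w w.
    have [->|/(proj2 sG)/ltW//] := eqVneq w 0.
    by rewrite /gram_inner !mul0mx mxE.
  by move=> /sqr_sqrtr <- _; rewrite -/(riem_norm g x w) w1 expr1n.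
pose d1 : 'rV[R]_2 := delta_mx 0 ord0.
have d10 : d1 != 0.
  by apply/eqP => /matrixP /(_ 0 ord0); rewrite !mxE /=; apply/eqP/oner_neq0.
pose e1 := (riem_norm g x d1)^-1 *: d1.
have e11 : gram_inner (g x) e1 e1 = 1.
  have p := proj2 sG _ d10.
  rewrite gram_innerZl gram_innerZr mulrA -expr2 exprVn sqr_sqrtr; last exact: ltW.
  by rewrite mulVf// lt0r_neq0.
have [s s0 es] := rot_by_exists sG (unit_inner _ xi1) e11.
by exists s => // t; rewrite addrC -rot_byD// -es.
Qed.

Lemma fibre_averageE v x xi : riem_norm g x xi = 1 ->
  let f t := v x (rot_by (g x) t xi) in continuous f ->
  fibre_average g v x =
  (2 * pi)^-1 * circle_sum f.
Proof.
move=> xi1 f cf; have [s s0 cs] := circle_pt_rot xi1.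
rewrite /fibre_average /circle_integral preimage_setT setIT; congr (_ * _).
rewrite -(circle_sumE cf _ s0).
  by apply: eq_Rintegral => t _; rewrite /= cs.
by move=> t; rewrite /f rot_by_periodic.
Qed.

(** For eta at angle t from xi the two inner products in the kernel are cos t
    and sin t, and |eta - xi| is the chord 2 |sin (t / 2)|. *)
Lemma hilbertE v x xi : riem_norm g x xi = 1 ->
  let f t := v x (rot_by (g x) t xi) in continuous f ->
  (exists C, forall t, 0 <= t <= pi -> `|f t - f (- t)| <= C * t) ->
  hilbert g v x xi =
  (2 * pi)^-1 * odd_transform f.
Proof.
move=> xi1 f cf lf; have [s s0 cs] := circle_pt_rot xi1; have sG := spd_gram x.
have fp t : f (t + 2 * pi) = f t by rewrite /f rot_by_periodic.
have xi2 : gram_inner (g x) xi xi = 1.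
  rewrite -[RHS](expr1n _ 2) -xi1 /riem_norm sqr_sqrtr//.
  have [->|/(proj2 sG)/ltW//] := eqVneq xi 0.
  by rewrite /riem_inner !mul0mx mxE.
rewrite /hilbert; congr (_ * _); apply: cvg_lim => //.
apply: cvg_trans (principal_value_cvg cf fp lf s0).
suff -> : (fun e => circle_integral g x [set eta | e < riem_norm g x (eta - xi)]
         (fun eta =>
            (1 + riem_inner g x xi eta) / riem_inner g x (perp g x xi) eta
            * v x eta)) = 
   (fun e => Rintegral mu `[0, 2 * pi] (fun t =>
    ((fun r => half_cot r * f r) \_ (far_set e)) (t + s))) by [].
apply/funext => e; rewrite /circle_integral Rintegral_mkcondr.
apply: eq_Rintegral => t _; rewrite !patchE.
set r := t + s.
have ir : gram_inner (g x) xi (rot_by (g x) r xi) = cos r.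
  have := gram_inner_rot_by 0 r xi sG; rewrite rot_by0 => ->.
  by rewrite xi2 subr0 mulr1.
have nr : riem_norm g x (rot_by (g x) r xi - xi) = 2 * `|sin (r / 2)|.
  rewrite /riem_norm riem_innerE -[- xi]scaleN1r.
  have -> : gram_inner (g x) (rot_by (g x) r xi + -1 *: xi)
     (rot_by (g x) r xi + -1 *: xi) = (2 * sin (r / 2)) ^+ 2.
    have := gram_inner_rot_by r r xi sG; rewrite xi2 subrr cos0 mulr1.
    move: ir; set rho := rot_by _ _ _; move: rho => rho ir rr.
    rewrite !(gram_innerDl, gram_innerDr, gram_innerZl, gram_innerZr).
    rewrite (gram_innerC rho xi)// ir rr xi2.
    have -> : r = r / 2 + r / 2 by field.
    rewrite cosD; have -> : (r / 2 + r / 2) / 2 = r / 2 by field.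
    by have := cos2Dsin2 (r / 2); lra.
  by rewrite sqrtr_sqr normrM ger0_norm.
have -> : (t \in circle_pt g x @^-1` [set eta | e < riem_norm g x (eta - xi)])
  = (r \in far_set e).
  by apply: asbool_equiv_eq; rewrite /far_set /= cs nr.
case: ifP => // _; rewrite /= cs -half_cot_cos_sin -/r; congr (_ / _ * _).
- by rewrite riem_innerE ir.
- have -> : perp g x xi = rot_by (g x) (pi / 2) xi.
    by rewrite /rot_by cos_pihalf sin_pihalf scale0r scale1r add0r.
  rewrite riem_innerE gram_inner_rot_by// xi2 mulr1.
  by rewrite cosBpihalf.
Qed.

End FibreFormulas.

(** * The operators in a coordinate chart *)

Section ChartFormulas.
Variables (R : realType) (M : oriented_surface R) (g : riemannian_metric M).
Variables (c : atlas M) (y : 'rV[R]_2).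
Local Notation mu := (@lebesgue_measure R).
Implicit Types (w : 'rV[R]_2) (u : bundle_fun M).

Hypothesis y_img : chart_img c y.

Let x : M := chart_inv c y.
Let T := 'J (chart (chart_at x) \o chart_inv c) y.
Let G := metric_coef g c y.

Lemma tangent_ofE w : tangent_of c y w = w *m T.
Proof. by rewrite /T /jacobian mul_rV_lin1. Qed.

Lemma transition_det_gt0 : 0 < \det T.
Proof.
apply: transition_oriented; have [z cz zy] := y_img.
exists z => //; split => //.
by rewrite /x -zy chartK//; exact: chart_at_dom.
Qed.

Lemma metric_coefE : G = T *m g x *m T^T.
Proof.
apply/matrixP => j k; rewrite !mxE !tangent_ofE riem_innerE -gram_inner_congr.
rewrite /gram_inner -rowE -[X in _ *m X]trmxK trmx_delta.
rewrite trmxK -colE !mxE.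
by [].
Qed.

Lemma spd_metric_coef : spd G.
Proof.
rewrite metric_coefE; apply: spd_congr; first exact: spd_gram.
by rewrite lt0r_neq0// transition_det_gt0.
Qed.

Lemma riem_norm_tangent w :
  riem_norm g x (tangent_of c y w) = Num.sqrt (gram_inner G w w).
Proof. by rewrite tangent_ofE metric_coefE gram_inner_congr. Qed.

Section Direction.
Variable w : 'rV[R]_2.
Hypothesis w0 : w != 0.

Let eta := (riem_norm g x (tangent_of c y w))^-1 *: tangent_of c y w.

Lemma riem_norm_normalized : riem_norm g x eta = 1.
Proof.
have p := proj2 spd_metric_coef _ w0.
rewrite /riem_norm riem_innerE gram_innerZl gram_innerZr.
rewrite tangent_ofE -gram_inner_congr -metric_coefE -tangent_ofE.
rewrite riem_norm_tangent mulrA -expr2 exprVn sqr_sqrtr; last exact: ltW.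
by rewrite mulVf ?sqrtr1// lt0r_neq0.
Qed.

(** The map tangent_of is an orientation preserving isometry from G to the
    metric at x, so it commutes with rotations, which preserve length. *)
Lemma local_ext_rot u t :
  local_ext g u c (y, rot_by G t w) = u x (rot_by (g x) t eta).
Proof.
rewrite /local_ext /= -/x; congr (u x _).
rewrite rot_byZ ?riem_norm_tangent; last exact: spd_gram.
rewrite gram_inner_rot_by; last exact: spd_metric_coef.
rewrite subrr cos0 mul1r; congr (_ *: _).
rewrite !tangent_ofE rot_by_congr; [|exact: spd_gram|exact: transition_det_gt0].
by rewrite metric_coefE.
Qed.

Lemma local_ext_average u :
  let F t := local_ext g u c (y, rot_by G t w) in continuous F ->
  local_ext g (pullback (fibre_average g u)) c (y, w) =
  (2 * pi)^-1 * circle_sum F.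
Proof.
move=> F; have -> : F = fun t => u x (rot_by (g x) t eta).
  by apply/funext => t; exact: local_ext_rot.
move=> cF; rewrite /local_ext/= /pullback -/x.
by rewrite (fibre_averageE riem_norm_normalized).
Qed.

Lemma local_ext_hilbert u :
  let F t := local_ext g u c (y, rot_by G t w) in continuous F ->
  (exists C, forall t, 0 <= t <= pi -> `|F t - F (- t)| <= C * t) ->
  local_ext g (hilbert g u) c (y, w) =
  (2 * pi)^-1 * odd_transform F.
Proof.
move=> F; have -> : F = fun t => u x (rot_by (g x) t eta).
  by apply/funext => t; exact: local_ext_rot.
by move=> cF lF; rewrite /local_ext/= -/x (hilbertE riem_norm_normalized).
Qed.

End Direction.
End ChartFormulas.

(** * Calculus along curves *)

Section Calculus.
Variable R : realType.
Implicit Types V W : normedModType R.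

Lemma is_derive1_is_diff W (c : R -> W) (t : R) (dc : W) :
  is_derive t 1 c dc -> is_diff t c ( *:%R^~ dc).
Proof.
move=> [ct <-]; have dt : differentiable c t by exact/derivable1_diffP.
apply: DiffDef => //; apply/funext => h.
by rewrite deriveE// -[in LHS](mulr1 h) -[h * 1]/(h *: 1) linearZ.
Qed.

Lemma is_diff_is_derive V W (f : V -> W) x v (df : V -> W) :
  is_diff x f df -> is_derive x v f (df v).
Proof.
move=> [fx <-]; apply: DeriveDef; first exact: diff_derivable.
by rewrite deriveE.
Qed.

Lemma is_derive_curve V W (c : R -> V) (f : V -> W) (t : R) (dc : V) :
  is_derive t 1 c dc -> differentiable f (c t) ->
  is_derive t 1 (fun s => f (c s)) ('D_dc f (c t)).
Proof.
move=> /is_derive1_is_diff dct fct.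
have -> : 'D_dc f (c t) = ('d f (c t) \o *:%R^~ dc) 1.
  by rewrite /= scale1r deriveE.
apply: is_diff_is_derive; apply: is_diff_comp.
exact/differentiableP.
Qed.

Lemma is_derive1_pair V W (c : R -> V) (d : R -> W) (t : R) dc dd :
  is_derive t 1 c dc -> is_derive t 1 d dd ->
  is_derive t 1 (fun s => (c s, d s)) (dc, dd).
Proof.
move=> /is_derive1_is_diff ct /is_derive1_is_diff dt.
have -> : (dc, dd) = (fun h : R => (h *: dc, h *: dd)) 1 by rewrite !scale1r.
exact: is_diff_is_derive.
Qed.

Lemma is_derive1_scalel W (k : R -> R) (w : W) (t dk : R) :
  is_derive t 1 k dk -> is_derive t 1 (fun s => k s *: w) (dk *: w).
Proof.
move=> kt; have [dw dwE] := is_diff_scalel (k t) w.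
by have := is_derive_curve kt dw; rewrite deriveE// dwE.
Qed.

Lemma is_derive1_line V (x v : V) (t : R) :
  is_derive t 1 (fun s : R => x + s *: v) v.
Proof.
have -> : v = 0 + 1 *: v by rewrite scale1r add0r.
apply: is_deriveD; rewrite scale1r add0r.
by rewrite -[X in is_derive _ _ _ X]scale1r; exact: is_derive1_scalel.
Qed.

Lemma is_derive1_continuous W (c : R -> W) (t : R) dc :
  is_derive t 1 c dc -> {for t, continuous c}.
Proof.
by case=> ct _; apply: differentiable_continuous; exact/derivable1_diffP.
Qed.

Lemma is_derive1_mx m n (N : R -> 'M[R]_(m, n)) (t : R) dN i j :
  is_derive t 1 N dN -> is_derive t 1 (fun s => N s i j) (dN i j).
Proof.
move=> [Nt <-]; rewrite derive_mx// mxE.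
by apply: DeriveDef => //; move/derivable_mxP : Nt; exact.
Qed.

Lemma derive_directionD V W (f : V -> W) x v w : differentiable f x ->
  'D_(v + w) f x = 'D_v f x + 'D_w f x.
Proof. by move=> fx; rewrite !deriveE// linearD. Qed.

Lemma derive_directionZ V W (f : V -> W) x k v : differentiable f x ->
  'D_(k *: v) f x = k *: 'D_v f x.
Proof. by move=> fx; rewrite !deriveE// linearZ. Qed.

Lemma derive_along_line V W (f : V -> W) p v :
  'D_v f p = 'D_1 (fun s : R => f (p + s *: v)) (0 : R).
Proof.
apply: (congr1 (fun q : R -> W => lim (q @ 0^'))); apply/funext => h /=.
by rewrite scale0r !addr0 [h *: 1]mulr1 (addrC p).
Qed.

Lemma smooth_on_differentiable V W (D : set V) (f : V -> W) p :
  smooth_on D f -> D p -> differentiable f p.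
Proof. by move=> /(_ [::] p). Qed.

Lemma smooth_on_derive V W (D : set V) (f : V -> W) v :
  smooth_on D f -> smooth_on D ('D_v f).
Proof. by move=> sf vs p Dp; have := sf (rcons vs v) p Dp; rewrite foldr_rcons. Qed.

Lemma smooth_on_continuous V W (D : set V) (f : V -> W) p :
  smooth_on D f -> D p -> {for p, continuous f}.
Proof. by move=> sf Dp; apply/differentiable_continuous/(smooth_on_differentiable sf). Qed.

(** A compactness argument; it supplies every uniform bound on derivatives
    needed for domination. *)
Lemma rectangle_bound (f : R -> R -> R) (a d : R) : 0 < d ->
  (forall t s, `|s| < d -> {for (t, s), continuous (fun p : R * R => f p.1 p.2)}) ->
  exists C, forall t s, `|t| <= a -> `|s| <= d / 2 -> `|f t s| <= C.
Proof.
move=> d0 cf; pose K : set (R * R) := `[- a, a] `*` `[- (d / 2), d / 2].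
have : compact ((fun p : R * R => f p.1 p.2) @` K).
  apply: continuous_compact; last by apply: compact_setX; exact: segment_compact.
  apply: continuous_in_subspaceT => -[t s] /set_mem [_ /=].
  rewrite in_itv/= => hs; apply: cf.
  have : `|s| <= d / 2 by rewrite ler_norml.
  by lra.
move=> /compact_bounded [C [_ hC]]; exists (C + 1) => t s ta sd.
have /hC : C < C + 1 by rewrite ltrDl.
apply; exists (t, s) => //; split => /=; rewrite in_itv/= -ler_norml//.
Qed.

(** Mean value theorem on [- t, t]. *)
Lemma odd_part_bound (f df : R -> R) (C a : R) : 0 <= a ->
  (forall t : R, is_derive t 1 f (df t)) -> (forall t, `|t| <= a -> `|df t| <= C) ->
  forall t, 0 <= t <= a -> `|f t - f (- t)| <= 2 * C * t.
Proof.
move=> a0 fd dC t /andP[t0 ta].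
have [||c cI ->] := @MVT_segment R f df (- t) t _ (fun x _ => fd x).
- by lra.
- apply: continuous_subspaceT => x; apply: differentiable_continuous.
  by apply/derivable1_diffP; case: (fd x).
have tt : 0 <= t + t by lra.
rewrite normrM opprK (ger0_norm tt).
rewrite (mulrC 2) -mulrA; have -> : t + t = 2 * t by ring.
apply: ler_wpM2r; first by lra.
apply: dC; rewrite in_itv/= in cI; rewrite ler_norml; lra.
Qed.

(** On a bounded interval a constant bound on the derivative is an integrable
    dominating function. *)
Lemma derive_under_integral (a b d C : R) (f df : R -> R -> R) : 0 < d ->
  (forall s, `|s| < d ->
    (@lebesgue_measure R).-integrable `[a, b] (EFin \o f ^~ s)) ->
  (forall t s : R, `|s| < d -> is_derive s 1 (f t) (df t s)) ->
  (forall t s, t \in `[a, b] -> `|s| < d -> `|df t s| <= C) ->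
  is_derive (0 : R) 1
    (fun s => Rintegral (@lebesgue_measure R) `[a, b] (f ^~ s))
    (Rintegral (@lebesgue_measure R) `[a, b] (df ^~ 0)).
Proof.
move=> d0 fi fd dC; pose I : set R := `]- d, d[%classic.
have I0 : I 0 by rewrite /I/= in_itv/=; lra.
have IE s : I s -> `|s| < d by rewrite /I/= in_itv/= ltr_norml.
have mab : measurable (`[a, b] : set (measurableTypeR R)) by [].
have d1E t s : I s -> partial1of2 (fun s t => f t s) s t = df t s.
  move=> /IE sd; rewrite partial1of2E; apply: derive_val; exact: fd.
pose C' : R -> R := cst `|C|.
have C0 : forall y, 0 <= C' y by move=> y; exact: normr_ge0.
have iC : (@lebesgue_measure R).-integrable `[a, b] (EFin \o C').
  apply: continuous_compact_integrable; first exact: segment_compact.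
  by apply: continuous_subspaceT => x; exact: cvg_cst.
have fi' s : I s -> (@lebesgue_measure R).-integrable `[a, b] (EFin \o (fun t => f t s)).
  by move=> /IE; exact: fi.
have fd' s t : I s -> `[a, b]%classic t -> derivable (f t) s 1.
  by move=> /IE sd _; case: (fd t s sd).
have fC s t : I s -> `[a, b]%classic t -> `|partial1of2 (fun s t => f t s) s t| <= C' t.
  move=> Is ab; rewrite d1E//; apply: (le_trans (dC _ _ _ (IE _ Is))) => //.
  exact: ler_norm.
apply: DeriveDef.
  exact: (derivable_under_integral mab I0 fi' fd' C0 iC fC).
rewrite -derive1E (differentiation_under_integral mab I0 fi' fd' C0 iC fC).
by apply: eq_Rintegral => t _; exact: d1E.
Qed.

End Calculus.

(** * The quarter turn along a curve of metrics *)

Section QuarterTurnCurve.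
Variable R : realType.
Implicit Types (G dG : 'M[R]_2) (v dv w : 'rV[R]_2).

Local Notation d0 := (delta_mx 0 ord0 : 'rV[R]_2).
Local Notation d1 := (delta_mx 0 ord_max : 'rV[R]_2).

Lemma row2_decomp v : v = v 0 ord0 *: d0 + v 0 ord_max *: d1.
Proof.
by apply: row2_eq; rewrite !mxE /= ?(mulr0, mulr1, addr0, add0r).
Qed.

(** The determinant of a symmetric matrix, read off its upper triangle, so
    that it stays polynomial in three independent entries. *)
Definition det_sym G := G ord0 ord0 * G ord_max ord_max - G ord0 ord_max * G ord0 ord_max.
(** The components of rot90 G v are flat0 and flat1 divided by the area
    element; both are bilinear in G and v, so they obey the product rule. *)
Definition flat0 G v := G ord_max ord_max * v 0 ord_max + G ord0 ord_max * v 0 ord0.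
Definition flat1 G v := - (G ord0 ord_max * v 0 ord_max + G ord0 ord0 * v 0 ord0).

(** Derivative of det_sym at G in the direction dG. *)
Definition ddet_sym G dG := (dG ord0 ord0 * G ord_max ord_max
  + G ord0 ord0 * dG ord_max ord_max) - (dG ord0 ord_max * G ord0 ord_max + 
   G ord0 ord_max * dG ord0 ord_max).

(** Derivative of rot90 at (G, v) in the direction (dG, dv), by the quotient
    rule; a closed formula shows its continuity and enters the verification
    that the quarter turn is parallel. *)
Definition drot90 G dG v dv :=
  let s := Num.sqrt (det_sym G) in
  let ds := (2 * s)^-1 * ddet_sym G dG in
  ((flat0 dG v + flat0 G dv) / s - flat0 G v * (ds / (s * s))) *: d0
  + ((flat1 dG v + flat1 G dv) / s - flat1 G v * (ds / (s * s))) *: d1.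

Lemma spd_det_sym G : spd G -> 0 < det_sym G.
Proof.
move=> /spd_param[a [b [s [a0 s0 [G00 G01 G10 G11] _]]]].
rewrite /det_sym G00 G01 G11.
have -> : a * ((s ^+ 2 + b ^+ 2) / a) - b * b = s ^+ 2.
  by field; rewrite lt0r_neq0.
by rewrite exprn_gt0.
Qed.

Lemma rot90_coords G v : spd G -> rot90 G v =
  (flat0 G v / Num.sqrt (det_sym G)) *: d0 + (flat1 G v / Num.sqrt (det_sym G)) *: d1.
Proof.
move=> sG; have [a [b [s [a0 s0 [G00 G01 G10 G11] E0 E1]]]] := rot90E sG.
have -> : Num.sqrt (det_sym G) = s.
  have -> : det_sym G = s ^+ 2.
    by rewrite /det_sym G00 G01 G11; field; rewrite lt0r_neq0.
  by rewrite sqrtr_sqr gtr0_norm.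
by rewrite [LHS]row2_decomp E0 E1 /flat0 /flat1 G00 G01 G11.
Qed.

Lemma is_derive1_mul (f h : R -> R) (t df dh : R) :
  is_derive t 1 f df -> is_derive t 1 h dh ->
  is_derive t 1 (fun r => f r * h r) (df * h t + f t * dh).
Proof.
move=> fd hd; have e := is_deriveM fd hd; apply: (is_derive_eq e).
by rewrite -![_ *: _]/(_ * _); ring.
Qed.

Lemma is_derive1_inv (f : R -> R) (t df : R) : f t != 0 ->
  is_derive t 1 f df ->
  is_derive t 1 (fun r => (f r)^-1) (- (df / (f t * f t))).
Proof.
move=> f0 fd; have e := is_deriveV f0 fd; apply: (is_derive_eq e).
by rewrite -![_ *: _]/(_ * _); field.
Qed.

Lemma is_derive_rot90 (G : R -> 'M[R]_2) (v : R -> 'rV[R]_2) (t : R) dG dv :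
  (\forall r \near t, spd (G r)) ->
  is_derive t 1 G dG -> is_derive t 1 v dv ->
  is_derive t 1 (fun r => rot90 (G r) (v r)) (drot90 (G t) dG (v t) dv).
Proof.
move=> sG Gd vd; have Gij i j := is_derive1_mx i j Gd.
have vi j := is_derive1_mx 0 j vd.
have st := nbhs_singleton sG.
apply: (@near_eq_is_derive _ _ _ (fun r =>
  (flat0 (G r) (v r) / Num.sqrt (det_sym (G r))) *: d0
  + (flat1 (G r) (v r) / Num.sqrt (det_sym (G r))) *: d1)).
  by near=> r; rewrite -rot90_coords//; near: r.
have dd : is_derive t 1 (fun r => det_sym (G r)) (ddet_sym (G t) dG).
  rewrite /det_sym /ddet_sym.
  by apply: is_deriveB; exact: is_derive1_mul.
have dt0 : 0 < det_sym (G t) by exact: spd_det_sym.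
have ds := @is_derive1_comp R Num.sqrt (fun r =>
  det_sym (G r)) t _ _ (is_derive1_sqrt dt0) dd.
have s0 : Num.sqrt (det_sym (G t)) != 0 by rewrite lt0r_neq0// sqrtr_gt0.
have df0 : is_derive t 1 (fun r => flat0 (G r) (v r)) (flat0 dG (v t) + flat0 (G t) dv).
  have e := is_deriveD (is_derive1_mul (Gij ord_max ord_max) (vi ord_max))
    (is_derive1_mul (Gij ord0 ord_max) (vi ord0)).
  by apply: (is_derive_eq e); rewrite /flat0; ring.
have df1 : is_derive t 1 (fun r => flat1 (G r) (v r)) (flat1 dG (v t) + flat1 (G t) dv).
  have e := is_deriveN (is_deriveD (is_derive1_mul (Gij ord0 ord_max) (vi ord_max))
    (is_derive1_mul (Gij ord0 ord0) (vi ord0))).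
  by apply: (is_derive_eq e); rewrite /flat1; ring.
have div (f : R -> R) (df : R) : is_derive t 1 f df ->
  is_derive t 1 (fun r => f r / Num.sqrt (det_sym (G r)))
  (df / Num.sqrt (det_sym (G t)) - f t * ((2 * Num.sqrt (det_sym (G t)))^-1 * ddet_sym
    (G t) dG
    / (Num.sqrt (det_sym (G t)) * Num.sqrt (det_sym (G t))))).
  move=> fd; have e := is_derive1_mul fd (@is_derive1_inv (fun r =>
    Num.sqrt (det_sym (G r))) t _ s0 ds).
  by apply: (is_derive_eq e); rewrite mulrN.
by apply: is_deriveD; apply: is_derive1_scalel; exact: div.
Unshelve. all: by end_near. Qed.

Lemma drot90_cst G v dv : spd G -> drot90 G 0 v dv = rot90 G dv.
Proof.
move=> sG; rewrite rot90_coords// /drot90 /ddet_sym.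
have -> : flat0 0 v = 0 by rewrite /flat0 !mxE !mul0r addr0.
have -> : flat1 0 v = 0 by rewrite /flat1 !mxE !mul0r addr0 oppr0.
by rewrite !mxE !(mul0r, mulr0, oppr0, addr0, add0r, subr0).
Qed.

End QuarterTurnCurve.

(** * Directional derivatives of functions of a point and a vector *)

Section DirectionalDerivatives.
Variable R : realType.
Local Notation rV := 'rV[R]_2.
Local Notation d0 := (delta_mx 0 ord0 : 'rV[R]_2).
Local Notation d1 := (delta_mx 0 ord_max : 'rV[R]_2).
Variables (O : set (rV * rV)) (O_open : open O).
Implicit Types (f : rV * rV -> R) (z p : rV * rV).

Lemma derive_basis f p z : differentiable f p -> 'D_z f p =
  z.1 0 ord0 * 'D_(d0, 0) f p + z.1 0 ord_max * 'D_(d1, 0) f p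
  + (z.2 0 ord0 * 'D_(0, d0) f p + z.2 0 ord_max * 'D_(0, d1) f p).
Proof.
move=> fp.
have -> : z = (z.1 0 ord0 *: (d0, 0) + z.1 0 ord_max *: (d1, 0))
  + (z.2 0 ord0 *: (0, d0) + z.2 0 ord_max *: (0, d1)) :> rV * rV.
  by rewrite [LHS]surjective_pairing; congr (_, _);
    rewrite /= !scaler0 !(add0r, addr0) -row2_decomp.
by rewrite !derive_directionD// !derive_directionZ//= !mxE /= !mulr0 !addr0 !add0r !mulr1.
Qed.

Lemma derive_basis_pair f p (v w : rV) : differentiable f p -> 'D_(v, w) f p =
  v 0 ord0 * 'D_(d0, 0) f p + v 0 ord_max * 'D_(d1, 0) f p
  + (w 0 ord0 * 'D_(0, d0) f p + w 0 ord_max * 'D_(0, d1) f p).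
Proof. exact: derive_basis. Qed.

Lemma derive_vertical f p (v : rV) : differentiable f p -> 'D_(0, v) f p =
  v 0 ord0 * 'D_(0, d0) f p + v 0 ord_max * 'D_(0, d1) f p.
Proof.
have z i : (0 : rV) 0 i = 0 by rewrite mxE.
by move=> fp; rewrite (derive_basis_pair 0 v fp) (z ord0) (z ord_max) !mul0r !add0r.
Qed.

Lemma derive_split f p (v w : rV) : differentiable f p ->
  'D_(v, w) f p = 'D_(v, 0) f p + 'D_(0, w) f p.
Proof.
have z i : (0 : rV) 0 i = 0 by rewrite mxE.
move=> fp; rewrite (derive_basis_pair v w fp) (derive_basis_pair v 0 fp).
by rewrite (derive_vertical w fp) (z ord0) (z ord_max) !mul0r !addr0.
Qed.

(** Derivative along z2 of the derivative along the fixed direction z1. *)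
Definition second_derive f p z1 z2 :=
  z1.1 0 ord0 * 'D_z2 ('D_(d0, 0) f) p + z1.1 0 ord_max * 'D_z2 ('D_(d1, 0) f) p
  + (z1.2 0 ord0 * 'D_z2 ('D_(0, d0) f) p + z1.2 0 ord_max * 'D_z2 ('D_(0, d1) f) p).

Lemma cvg_coord (T : Type) (F : set_system T) {FF : Filter F} m n
  (N : T -> 'M[R]_(m, n)) (N0 : 'M[R]_(m, n)) i j :
  N x @[x --> F] --> N0 -> N x i j @[x --> F] --> N0 i j.
Proof. move=> h; exact: (cvg_comp _ _ h (@coord_continuous _ _ _ i j N0)). Qed.

Lemma cvg_drot90 (T : Type) (F : set_system T) {FF : Filter F}
    (G_ dG_ : T -> 'M[R]_2) (v_ : T -> rV) G dG v dv : 0 < det_sym G ->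
  G_ x @[x --> F] --> G -> dG_ x @[x --> F] --> dG -> v_ x @[x --> F] --> v ->
  drot90 (G_ x) (dG_ x) (v_ x) dv @[x --> F] --> drot90 G dG v dv.
Proof.
move=> dG0 GG dGG vv; have s0 : 0 < Num.sqrt (det_sym G) by rewrite sqrtr_gt0.
have Gij i j := @cvg_coord _ _ _ _ _ _ _ i j GG.
have dGij i j := @cvg_coord _ _ _ _ _ _ _ i j dGG.
have vi i j := @cvg_coord _ _ _ _ _ _ _ i j vv.
have ds : det_sym (G_ x) @[x --> F] --> det_sym G.
  by apply: cvgB; apply: cvgM; exact: Gij.
have ss : Num.sqrt (det_sym (G_ x)) @[x --> F] --> Num.sqrt (det_sym G).
  by apply: (cvg_comp _ _ ds); exact: sqrt_continuous.
have dds : ddet_sym (G_ x) (dG_ x) @[x --> F] --> ddet_sym G dG.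
  by apply: cvgB; apply: cvgD; apply: cvgM; first [exact: Gij|exact: dGij].
have q : (2 * Num.sqrt (det_sym (G_ x)))^-1 * ddet_sym (G_ x) (dG_ x) /
   (Num.sqrt (det_sym (G_ x)) * Num.sqrt (det_sym (G_ x))) @[x --> F] -->
   (2 * Num.sqrt (det_sym G))^-1 * ddet_sym G dG /
   (Num.sqrt (det_sym G) * Num.sqrt (det_sym G)).
  apply: cvgM; first apply: cvgM => //.
    apply: cvgV; first by rewrite lt0r_neq0// mulr_gt0.
    by apply: cvgM => //; exact: cvg_cst.
  by apply: cvgV; [rewrite lt0r_neq0// mulr_gt0|exact: cvgM].
have sV : (Num.sqrt (det_sym (G_ x)))^-1 @[x --> F] --> (Num.sqrt (det_sym G))^-1.
  by apply: cvgV; rewrite ?lt0r_neq0.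
apply: cvgD; apply: cvgZr_tmp; apply: cvgB; apply: cvgM => //.
- by apply: cvgD; apply: cvgD; apply: cvgM;
  first [exact: Gij|exact: dGij|exact: vi|exact: cvg_cst].
- by apply: cvgD; apply: cvgM; first [exact: Gij|exact: dGij|exact: vi|exact: cvg_cst].
- by apply: cvgD; apply: cvgN; apply: cvgD; apply: cvgM;
  first [exact: Gij|exact: dGij|exact: vi|exact: cvg_cst].
- by apply: cvgN; apply: cvgD; apply: cvgM;
  first [exact: Gij|exact: dGij|exact: vi|exact: cvg_cst].
Qed.

(** Joint continuity in the direction and the point: in a basis only the
    partial derivatives remain, and these are continuous functions of p. *)
Lemma cvg_derive (T : Type) (F : set_system T) {FF : Filter F} f
    (z_ p_ : T -> rV * rV) z p : smooth_on O f -> O p ->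
  z_ x @[x --> F] --> z -> p_ x @[x --> F] --> p ->
  'D_(z_ x) f (p_ x) @[x --> F] --> 'D_z f p.
Proof.
move=> sf Op zz pp.
have nO : \forall x \near F, O (p_ x) by apply: pp; exact: open_nbhs_nbhs.
have z1 : (z_ x).1 @[x --> F] --> z.1 by apply: (cvg_comp _ _ zz); exact: cvg_fst.
have z2 : (z_ x).2 @[x --> F] --> z.2 by apply: (cvg_comp _ _ zz); exact: cvg_snd.
have ce e : 'D_e f (p_ x) @[x --> F] --> 'D_e f p.
  exact: (cvg_comp _ _ pp (smooth_on_continuous (smooth_on_derive e sf) Op)).
rewrite (derive_basis _ (smooth_on_differentiable sf Op)).
apply: (@cvg_trans _ ((z_ x).1 0 ord0 * 'D_(d0, 0) f (p_ x)
    + (z_ x).1 0 ord_max * 'D_(d1, 0) f (p_ x)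
  + ((z_ x).2 0 ord0 * 'D_(0, d0) f (p_ x)
    + (z_ x).2 0 ord_max * 'D_(0, d1) f (p_ x)) @[x --> F])).
  apply: near_eq_cvg; near=> x; rewrite (derive_basis (z_ x))//.
  by apply: (smooth_on_differentiable sf); near: x.
by apply: cvgD; apply: cvgD; apply: cvgM; try exact: ce; apply: cvg_coord.
Unshelve. all: by end_near. Qed.

Lemma cvg_second_derive (T : Type) (F : set_system T) {FF : Filter F} f
    (y_ z_ p_ : T -> rV * rV) y z p : smooth_on O f -> O p ->
  y_ x @[x --> F] --> y -> z_ x @[x --> F] --> z -> p_ x @[x --> F] --> p ->
  second_derive f (p_ x) (y_ x) (z_ x) @[x --> F] --> second_derive f p y z.
Proof.
move=> sf Op yy zz pp.
have y1 : (y_ x).1 @[x --> F] --> y.1 by apply: (cvg_comp _ _ yy); exact: cvg_fst.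
have y2 : (y_ x).2 @[x --> F] --> y.2 by apply: (cvg_comp _ _ yy); exact: cvg_snd.
by apply: cvgD; apply: cvgD; apply: cvgM; try (apply: cvg_derive => //;
  exact: smooth_on_derive);
  apply: cvg_coord.
Qed.

Lemma is_derive_derive f (v w : R -> rV) (c : R -> rV * rV) (t : R) dv dw dc :
  smooth_on O f -> (forall s, O (c s)) ->
  is_derive t 1 v dv -> is_derive t 1 w dw -> is_derive t 1 c dc ->
  is_derive t 1 (fun s => 'D_(v s, w s) f (c s))
    ('D_(dv, dw) f (c t) + second_derive f (c t) (v t, w t) dc).
Proof.
move=> sf Oc vd wd cd.
have diff s := smooth_on_differentiable sf (Oc s).
have -> : (fun s => 'D_(v s, w s) f (c s)) = fun s =>
   v s 0 ord0 * 'D_(d0, 0) f (c s) + v s 0 ord_max * 'D_(d1, 0) f (c s)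
  + (w s 0 ord0 * 'D_(0, d0) f (c s) + w s 0 ord_max * 'D_(0, d1) f (c s)).
  by apply/funext => s; rewrite (derive_basis _ (diff s)).
have fd e : is_derive t 1 (fun s => 'D_e f (c s)) ('D_dc ('D_e f) (c t)).
  apply: is_derive_curve => //.
  exact: (smooth_on_differentiable (smooth_on_derive e sf) (Oc t)).
have e := is_deriveD (is_deriveD
  (is_derive1_mul (is_derive1_mx 0 ord0 vd) (fd (d0, 0)))
  (is_derive1_mul (is_derive1_mx 0 ord_max vd) (fd (d1, 0))))
  (is_deriveD
  (is_derive1_mul (is_derive1_mx 0 ord0 wd) (fd (0, d0)))
  (is_derive1_mul (is_derive1_mx 0 ord_max wd) (fd (0, d1)))).
apply: (is_derive_eq e); rewrite (derive_basis (dv, dw) (diff t)) /second_derive /=.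
have regroup (p q r s p' q' r' s' : R) :
  p + p' + (q + q') + (r + r' + (s + s')) = p + q + (r + s) + (p' + q' + (r' + s')).
  by ring.
exact: regroup.
Qed.

End DirectionalDerivatives.

(** * A smooth function along rotations of a moving vector *)

(** The angle t runs through a fibre while s moves the base point and the
    vector along a line of the chart. *)
Definition rot_point (R : realType) (G : 'rV[R]_2 -> 'M[R]_2)
    (y0 w0 a b : 'rV[R]_2) (t s : R) : 'rV[R]_2 * 'rV[R]_2 :=
  (y0 + s *: a, rot_by (G (y0 + s *: a)) t (w0 + s *: b)).

(** The derivative of rot_point in s. *)
Definition rot_velocity (R : realType) (G : 'rV[R]_2 -> 'M[R]_2)
    (y0 w0 a b : 'rV[R]_2) (t s : R) : 'rV[R]_2 * 'rV[R]_2 :=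
  (a, cos t *: b + sin t *:
    drot90 (G (y0 + s *: a)) ('D_a G (y0 + s *: a)) (w0 + s *: b) b).

Section RotationFamily.
Variable R : realType.
Implicit Types s t r : R.
Local Notation rV := 'rV[R]_2.
Local Notation mu := (@lebesgue_measure R).
Local Notation d0 := (delta_mx 0 ord0 : 'rV[R]_2).
Local Notation d1 := (delta_mx 0 ord_max : 'rV[R]_2).
Variables (D : set rV) (G : rV -> 'M[R]_2) (U : rV * rV -> R).
Let O := [set p : rV * rV | D p.1 /\ p.2 != 0].
Hypotheses (D_open : open D) (G_smooth : smooth_on D G)
  (G_spd : forall y, D y -> spd (G y)) (U_smooth : smooth_on O U).
Variables (y0 w0 a b : rV).
Hypotheses (Dy0 : D y0) (w0_neq0 : w0 != 0).

Lemma nonzero_vectors_open : open O.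
Proof.
have -> : O = (fst @^-1` D) `&` (snd @^-1` (~` [set 0])).
  by apply/seteqP; split => p [Dp p0]; split => //; apply/eqP.
apply: openI; apply: open_comp => //.
- by move=> [p q] _; exact: cvg_fst.
- by move=> [p q] _; exact: cvg_snd.
- apply: closed_openC; apply: accessible_closed_set1.
  by apply: hausdorff_accessible; exact: norm_hausdorff.
Qed.

Let base s : rV := y0 + s *: a.
Let vect s : rV := w0 + s *: b.
Let quarter s := rot90 (G (base s)) (vect s).
Let dquarter s := drot90 (G (base s)) ('D_a G (base s)) (vect s) b.

Let point t s : rV * rV := (base s, cos t *: vect s + sin t *: quarter s).
Let velocity t s : rV * rV := (a, cos t *: b + sin t *: dquarter s).

Let W t s := U (rot_point G y0 w0 a b t s).
Let Q t s := 'D_(rot_velocity G y0 w0 a b t s) U (rot_point G y0 w0 a b t s).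

Lemma line_in_domain : exists2 d : R, 0 < d &
  forall s : R, `|s| < d -> D (base s) /\ vect s != 0.
Proof.
have : nbhs (0 : R) [set s | O (base s, vect s)].
  have h := is_derive1_continuous
    (is_derive1_pair (is_derive1_line y0 a 0) (is_derive1_line w0 b 0)).
  apply: (h O); apply: open_nbhs_nbhs; split; first exact: nonzero_vectors_open.
  by rewrite /O /= !scale0r !addr0.
move=> /nbhs_ballP[d d0 h]; exists d => // s sd; apply: h.
by rewrite -ball_normE /= sub0r normrN.
Qed.

Variable d : R.
Hypotheses (d_gt0 : 0 < d)
  (Hd : forall s : R, `|s| < d -> D (base s) /\ vect s != 0).

Let Opoint t s : `|s| < d -> O (point t s).
Proof. by move=> /Hd[Db v0]; split => //; apply: rot_by_neq0 => //; exact: G_spd. Qed.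

Let near_small (s : R) : `|s| < d -> \forall r \near s, `|r : R| < d.
Proof.
move=> sd; apply/nbhs_ballP; exists (d - `|s|); first by rewrite /= subr_gt0.
move=> r; rewrite -ball_normE /= distrC => sr.
by have := ler_normD (r - s) s; rewrite subrK; lra.
Qed.

Let base_derive s : is_derive s 1 base a.
Proof. exact: is_derive1_line. Qed.

Let vect_derive s : is_derive s 1 vect b.
Proof. exact: is_derive1_line. Qed.

Let quarter_derive s : `|s| < d -> is_derive s 1 quarter (dquarter s).
Proof.
move=> sd; have Gd : is_derive s 1 (fun r => G (base r)) ('D_a G (base s)).
  apply: is_derive_curve; first exact: base_derive.
  exact: (smooth_on_differentiable G_smooth (Hd sd).1).
have Gspd : \forall r \near s, spd (G (base r)).
  by have := near_small sd; apply: filterS => r /Hd[+ _]; exact: G_spd.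
exact: (is_derive_rot90 Gspd Gd (vect_derive s)).
Qed.

Let point_derive t s : `|s| < d -> is_derive s 1 (point t) (velocity t s).
Proof.
move=> sd; have td := is_deriveD (is_deriveZ (cos t) (vect_derive s))
  (is_deriveZ (sin t) (quarter_derive sd)).
exact: (is_derive1_pair (base_derive s) td).
Qed.

Let W_derive t s : `|s| < d -> is_derive s 1 (W t) (Q t s).
Proof.
move=> sd; apply: is_derive_curve; first exact: point_derive.
exact: (smooth_on_differentiable U_smooth (Opoint t sd)).
Qed.

(** The derivative of point in t. *)
Let spin t s : rV * rV := (0, (- sin t) *: vect s + cos t *: quarter s).

Let spin_derive t s : is_derive t 1 (point^~ s) (spin t s).
Proof.
apply: is_derive1_pair => //.
by apply: is_deriveD; apply: is_derive1_scalel.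
Qed.

(** The derivatives of W and of Q in t. *)
Let dW t s := 'D_(spin t s) U (point t s).

Let dQ t s := 'D_(0, (- sin t) *: b + cos t *: dquarter s) U (point t s)
  + second_derive U (point t s) (velocity t s) (spin t s).

Let W_spin t s : `|s| < d -> is_derive t 1 (W^~ s) (dW t s).
Proof.
move=> sd; apply: is_derive_curve; first exact: spin_derive.
exact: (smooth_on_differentiable U_smooth (Opoint t sd)).
Qed.

Let Q_spin t s : `|s| < d -> is_derive t 1 (Q^~ s) (dQ t s).
Proof.
move=> sd; have vd : is_derive t 1 (fun=> a) (0 : rV) by exact: is_derive_cst.
have wd := is_deriveD (is_derive1_scalel b (is_derive_cos t))
  (is_derive1_scalel (dquarter s) (is_derive_sin t)).
exact: (is_derive_derive U_smooth (fun r => Opoint r sd) vd wd (spin_derive t s)).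
Qed.

Let dquarter_continuous s : `|s| < d -> {for s, continuous dquarter}.
Proof.
move=> sd; have [Db _] := Hd sd.
have cb := is_derive1_continuous (base_derive s).
apply: cvg_drot90; first exact/spd_det_sym/G_spd.
- exact: (cvg_comp _ _ cb (smooth_on_continuous G_smooth Db)).
- exact: (cvg_comp _ _ cb (smooth_on_continuous (smooth_on_derive a G_smooth) Db)).
- exact: (is_derive1_continuous (vect_derive s)).
Qed.

Let cvg_pair_nbhs (V V' : normedModType R) (p : R * R) (f : R * R -> V)
    (h : R * R -> V') (v : V) (w : V') :
  f q @[q --> p] --> v -> h q @[q --> p] --> w ->
  (f q, h q) @[q --> p] --> ((v, w) : V * V').
Proof. by move=> fv hw; exact: cvg_pair fv hw. Qed.

Let cvg_snd_comp (V : normedModType R) (f : R -> V) t s :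
  {for s, continuous f} -> f p.2 @[p --> (t, s)] --> f s.
Proof. by move=> cf; exact: (cvg_comp _ _ (@cvg_snd _ _ (nbhs t) (nbhs s) _) cf). Qed.

Let cvg_fst_comp (f : R -> R) t s :
  continuous f -> f p.1 @[p --> (t, s)] --> f t.
Proof. by move=> cf; exact: (cvg_comp _ _ (@cvg_fst _ _ (nbhs t) (nbhs s) _) (cf t)). Qed.

Let cvg_turn (f g : R -> R) (v w : R -> rV) t s :
  continuous f -> continuous g ->
  {for s, continuous v} -> {for s, continuous w} ->
  f p.1 *: v p.2 + g p.1 *: w p.2 @[p --> (t, s)] --> f t *: v s + g t *: w s.
Proof.
move=> cf cg cv cw.
by apply: cvgD; apply: cvgZ; try exact: cvg_fst_comp; exact: cvg_snd_comp.
Qed.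

Let oppsin_continuous : continuous (fun t => - sin t).
Proof. by move=> t; apply: cvgN; exact: continuous_sin. Qed.

Let vect_continuous s : {for s, continuous vect}.
Proof. exact: (is_derive1_continuous (vect_derive s)). Qed.

Let quarter_continuous s : `|s| < d -> {for s, continuous quarter}.
Proof. by move=> sd; exact: (is_derive1_continuous (quarter_derive sd)). Qed.

Let cvg_point t s : `|s| < d -> point p.1 p.2 @[p --> (t, s)] --> point t s.
Proof.
move=> sd; apply: (@cvg_pair_nbhs _ _ (t, s) (fun p : R * R => base p.2)
  (fun p => cos p.1 *: vect p.2 + sin p.1 *: quarter p.2)).
  by apply: cvg_snd_comp; exact: (is_derive1_continuous (base_derive s)).
by apply: cvg_turn; [exact: continuous_cos|exact: continuous_sin|exact:
  vect_continuous|exact: quarter_continuous].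
Qed.

Let cvg_velocity t s : `|s| < d -> velocity p.1 p.2 @[p --> (t, s)] --> velocity t s.
Proof.
move=> sd; apply: (@cvg_pair_nbhs _ _ (t, s) (fun=> a)
  (fun p => cos p.1 *: b + sin p.1 *: dquarter p.2)).
  exact: cvg_cst.
have cb : {for s, continuous (fun=> b)} by exact: cvg_cst.
by apply: (@cvg_turn cos sin (fun=> b));
  [exact: continuous_cos|exact: continuous_sin|exact: cb|exact: dquarter_continuous].
Qed.

Let cvg_spin t s : `|s| < d -> spin p.1 p.2 @[p --> (t, s)] --> spin t s.
Proof.
move=> sd; apply: (@cvg_pair_nbhs _ _ (t, s) (fun=> 0 : rV)
  (fun p => (- sin p.1) *: vect p.2 + cos p.1 *: quarter p.2)).
  exact: cvg_cst.
by apply: (@cvg_turn (fun t => - sin t));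
  [exact: oppsin_continuous|exact: continuous_cos|exact: vect_continuous|exact:
  quarter_continuous].
Qed.

Let cvg_dW t s : `|s| < d -> dW p.1 p.2 @[p --> (t, s)] --> dW t s.
Proof.
move=> sd; apply: (cvg_derive nonzero_vectors_open U_smooth (Opoint t sd)).
  exact: cvg_spin.
exact: cvg_point.
Qed.

Let cvg_Q t s : `|s| < d -> Q p.1 p.2 @[p --> (t, s)] --> Q t s.
Proof.
move=> sd; apply: (cvg_derive nonzero_vectors_open U_smooth (Opoint t sd)).
  exact: cvg_velocity.
exact: cvg_point.
Qed.

Let cvg_dQ t s : `|s| < d -> dQ p.1 p.2 @[p --> (t, s)] --> dQ t s.
Proof.
move=> sd; apply: cvgD.
  apply: (cvg_derive nonzero_vectors_open U_smooth (Opoint t sd)); last exact: cvg_point.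
  apply: (@cvg_pair_nbhs _ _ (t, s) (fun=> 0 : rV)
    (fun p => (- sin p.1) *: b + cos p.1 *: dquarter p.2)).
    exact: cvg_cst.
  have cb : {for s, continuous (fun=> b)} by exact: cvg_cst.
  by apply: (@cvg_turn (fun t => - sin t) cos (fun=> b));
    [exact: oppsin_continuous|exact: continuous_cos|exact: cb|exact: dquarter_continuous].
apply: (cvg_second_derive nonzero_vectors_open U_smooth (Opoint t sd)).
- exact: cvg_velocity.
- exact: cvg_spin.
- exact: cvg_point.
Qed.

Let Q_bound : exists C, forall t s, `|t| <= pi -> `|s| <= d / 2 -> `|Q t s| <= C.
Proof. exact: (@rectangle_bound R Q pi d d_gt0 (fun t s sd => @cvg_Q t s sd)). Qed.

Let dQ_bound : exists C, forall t s, `|t| <= pi -> `|s| <= d / 2 -> `|dQ t s| <= C.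
Proof. exact: (@rectangle_bound R dQ pi d d_gt0 (fun t s sd => @cvg_dQ t s sd)). Qed.

Let dW_bound : exists C, forall t s, `|t| <= pi -> `|s| <= d / 2 -> `|dW t s| <= C.
Proof. exact: (@rectangle_bound R dW pi d d_gt0 (fun t s sd => @cvg_dW t s sd)). Qed.

Let half_small s : `|s| <= d / 2 -> `|s| < d.
Proof. by have := d_gt0 => d0 sd; lra. Qed.

Let point_periodic t s :
  rot_point G y0 w0 a b (t + 2 * pi) s = rot_point G y0 w0 a b t s.
Proof. by rewrite /rot_point /rot_by mulr_natl cosD2pi sinD2pi. Qed.

Let velocity_periodic t s :
  rot_velocity G y0 w0 a b (t + 2 * pi) s = rot_velocity G y0 w0 a b t s.
Proof. by rewrite /rot_velocity mulr_natl cosD2pi sinD2pi. Qed.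

Lemma circle_lipschitz_rot_point s : `|s| <= d / 2 -> circle_lipschitz (W^~ s).
Proof.
move=> sd; have sd' := half_small sd; split.
- by move=> t; exact: (is_derive1_continuous (W_spin t sd')).
- by move=> t; rewrite /W point_periodic.
- have [C dWC] := dW_bound; exists (2 * C) => t t0.
  apply: (odd_part_bound (pi_ge0 R) (fun t => W_spin t sd') _ t0) => r rpi.
  exact: dWC.
Qed.

(** The mixed derivative dQ is jointly continuous, so one constant serves all
    small s. *)
Let Q_odd_part_bound : exists C, forall s, `|s| <= d / 2 ->
  forall t, 0 <= t <= pi -> `|Q t s - Q (- t) s| <= C * t.
Proof.
have [C dQC] := dQ_bound; exists (2 * C) => s sd t t0.
apply: (odd_part_bound (pi_ge0 R) (fun t => Q_spin t (half_small sd)) _ t0) => r rpi.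
exact: dQC.
Qed.

Lemma circle_lipschitz_rot_velocity : circle_lipschitz (Q^~ 0).
Proof.
have s0 : `|0 : R| <= d / 2 by rewrite normr0 divr_ge0// ltW.
split.
- by move=> t; exact: (is_derive1_continuous (Q_spin t (half_small s0))).
- by move=> t; rewrite /Q point_periodic velocity_periodic.
- by have [C QC] := Q_odd_part_bound; exists C => t; exact: QC.
Qed.

(** The uniform bound on the odd part of the s-derivative compensates the
    singularity of the kernel and provides the dominating constant. *)
Lemma is_derive_odd_transform : is_derive (0 : R) 1
  (fun s => odd_transform (W^~ s)) (odd_transform (Q^~ 0)).
Proof.
have [C QC] := Q_odd_part_bound.
have d2 : 0 < d / 2 by rewrite divr_gt0.
have C0 : 0 <= C.
  have := QC 0 _ pi; rewrite normr0 pi_ge0 lexx => /(_ (ltW d2) isT).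
  by move=> /(le_trans (normr_ge0 _)); rewrite pmulr_lge0 ?pi_gt0.
apply: (@derive_under_integral R 0 pi (d / 2) (C * 2)
  (fun t s => half_cot t * (W t s - W (- t) s))
  (fun t s => half_cot t * (Q t s - Q (- t) s)) d2).
- move=> s /ltW /circle_lipschitz_rot_point [cW pW lW].
  exact: half_cot_odd_part_integrable cW pW lW.
- move=> t s /ltW/half_small sd.
  have e := is_deriveZ (half_cot t) (is_deriveB (W_derive t sd) (W_derive (- t) sd)).
  exact: e.
- move=> t s; rewrite in_itv/= => tpi /ltW sd.
  rewrite normrM; apply: (le_trans (ler_wpM2l (normr_ge0 _) (QC s sd t tpi))).
  by rewrite mulrCA ler_wpM2l// half_cot_bound.
Qed.

Lemma is_derive_circle_sum : is_derive (0 : R) 1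
  (fun s => circle_sum (W^~ s)) (circle_sum (Q^~ 0)).
Proof.
have [C QC] := Q_bound; have d2 : 0 < d / 2 by rewrite divr_gt0.
apply: (@derive_under_integral R 0 pi (d / 2) (C + C)
  (fun t s => W t s + W (- t) s) (fun t s => Q t s + Q (- t) s) d2).
- move=> s /ltW /circle_lipschitz_rot_point [cW pW lW].
  apply: continuous_compact_integrable; first exact: segment_compact.
  apply: continuous_subspaceT => t; apply: cvgD; first exact: cW.
  by apply: (@continuous_comp _ _ _ -%R (W^~ s)); [exact: opp_continuous|exact: cW].
- move=> t s /ltW/half_small sd.
  exact: (is_deriveD (W_derive t sd) (W_derive (- t) sd)).
- move=> t s; rewrite in_itv/= => /andP[t0 tpi] /ltW sd.
  apply: (le_trans (ler_normD _ _)); apply: lerD; apply: QC => //.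
    by rewrite ger0_norm.
  by rewrite normrN ger0_norm.
Qed.

End RotationFamily.

(** * The quarter turn is parallel *)

Section LeviCivita.
Variable R : realType.
Implicit Types (G : 'M[R]_2) (v : 'rV[R]_2).

(** The matrix dG l stands for the partial derivative of the metric
    coefficients along the l-th coordinate. *)
Definition levi_civita G (dG : 'I_2 -> 'M[R]_2) (i j k : 'I_2) : R :=
  2^-1 * \sum_l invmx G i l * (dG j l k + dG k l j - dG l j k).

(** In matrix form d_j J + [Gamma_j, J] = 0, applied to v, where J = rot90 G:
    the Levi-Civita connection preserves metric and orientation, hence J. In
    coordinates it is a field identity in the partial derivatives of the metric. *)
Lemma levi_civita_rot90 G dG v j m : spd G -> (forall l, (dG l)^T = dG l) ->
  drot90 G (dG j) v 0 0 m + \sum_k levi_civita G dG m j k * rot90 G v 0 k =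
  \sum_i (\sum_k levi_civita G dG i j k * v 0 k) * rot90 G (delta_mx 0 i) 0 m.
Proof.
move=> sG sdG; have [a [b [s [a0 s0 [G00 G01 G10 G11] dG']]]] := spd_param sG.
have d0 : \det G != 0 by rewrite dG' expf_neq0// lt0r_neq0.
have [i00 i01 i10 i11] := invmx2E d0.
have sq : Num.sqrt (det_sym G) = s.
  have -> : det_sym G = s ^+ 2.
    by rewrite /det_sym G00 G01 G11; field; rewrite lt0r_neq0.
  by rewrite sqrtr_sqr gtr0_norm.
have sd l : dG l ord_max ord0 = dG l ord0 ord_max by rewrite -[in LHS]sdG mxE.
have an0 : a != 0 by rewrite lt0r_neq0.
have sn0 : s != 0 by rewrite lt0r_neq0.
rewrite !sum_ord2 !rot90_coords// /drot90 sq /levi_civita !sum_ord2 /ddet_sym /flat0 /flat1.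
rewrite !i00 !i01 !i10 !i11 !G00 !G01 !G10 !G11 dG'.
move: j m; apply: ord2P; apply: ord2P;
  rewrite ?i00 ?i01 ?i10 ?i11 ?G00 ?G01 ?G10 ?G11 ?dG' !mxE /= !sd.
all: by field; rewrite an0 sn0.
Qed.

(** Let q be the quarter turn of v, dq its derivative and e i the quarter turns
    of the basis vectors. If the turn is parallel (hypothesis), then rotation by
    cos = C, sin = S sends the horizontal vector at v to the one at C v + S q:
    A and B are the partial derivatives at the rotated vector of the function
    to be differentiated. *)
Lemma turn_connection (Gam : 'I_2 -> 'I_2 -> R) (v q dq : 'rV[R]_2)
    (e : 'I_2 -> 'rV[R]_2) (A C S : R) (B : 'I_2 -> R) :
  (forall m, dq 0 m + \sum_k Gam m k * q 0 k =
    \sum_i (\sum_k Gam i k * v 0 k) * e i 0 m) ->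
  A - \sum_i \sum_k Gam i k * (C *: v + S *: q) 0 k * B i =
  A + ((C *: 0 + S *: dq) 0 ord0 * B ord0 + (C *: 0 + S *: dq) 0 ord_max * B ord_max)
  - \sum_i (\sum_k Gam i k * v 0 k) *
     ((C *: delta_mx 0 i + S *: e i) 0 ord0 * B ord0
      + (C *: delta_mx 0 i + S *: e i) 0 ord_max * B ord_max).
Proof.
move=> h; have := h ord_max; have := h ord0; rewrite !sum_ord2 !mxE /=.
by move=> /(canRL (addrK _)) -> /(canRL (addrK _)) ->; ring.
Qed.

End LeviCivita.

(** * Algebra of the folded integrals *)

Section CircleOperators.
Variable R : realType.
Local Notation mu := (@lebesgue_measure R).
Implicit Types (f h : R -> R) (k : R).

Lemma circle_lipschitz_bounded f : circle_lipschitz f ->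
  exists C, forall t, `|f t| <= C.
Proof.
move=> [cf pf _]; apply: (@periodic_continuous_bounded _ f (2 * pi)) => //.
by rewrite mulr_gt0// pi_gt0.
Qed.

Lemma circle_lipschitzD f h : circle_lipschitz f -> circle_lipschitz h ->
  circle_lipschitz (fun t => f t + h t).
Proof.
move=> [cf pf [C fC]] [ch ph [D hD]]; split.
- by move=> t; apply: cvgD; [exact: cf|exact: ch].
- by move=> t; rewrite pf ph.
- exists (C + D) => t t0.
  have -> : f t + h t - (f (- t) + h (- t)) = (f t - f (- t)) + (h t - h (- t)).
    by ring.
  by rewrite mulrDl (le_trans (ler_normD _ _))// lerD// ?fC ?hD.
Qed.

Lemma circle_lipschitzM f h : circle_lipschitz f -> circle_lipschitz h ->
  circle_lipschitz (fun t => f t * h t).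
Proof.
move=> lf lh; have [A fA] := circle_lipschitz_bounded lf.
have [B hB] := circle_lipschitz_bounded lh.
move: lf lh => [cf pf [C fC]] [ch ph [D hD]]; split.
- by move=> t; apply: cvgM; [exact: cf|exact: ch].
- by move=> t; rewrite pf ph.
- exists (C * B + A * D) => t t0.
  have -> : f t * h t - f (- t) * h (- t) =
      (f t - f (- t)) * h t + f (- t) * (h t - h (- t)) by ring.
  have -> : (C * B + A * D) * t = C * t * B + A * (D * t) by ring.
  rewrite (le_trans (ler_normD _ _))// !normrM lerD// ler_pM//; first exact: fC.
  exact: hD.
Qed.

Lemma circle_lipschitz_cst k : circle_lipschitz (fun=> k).
Proof.
split => //; first by move=> t; exact: cvg_cst.
by exists 0 => t _; rewrite subrr normr0 mul0r.
Qed.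

Lemma circle_lipschitzZ k f : circle_lipschitz f ->
  circle_lipschitz (fun t => k * f t).
Proof. by move=> lf; apply: circle_lipschitzM => //; exact: circle_lipschitz_cst. Qed.

Lemma circle_lipschitz_cos : circle_lipschitz (@cos R).
Proof.
split; first exact: continuous_cos.
  by move=> t; rewrite mulr_natl cosD2pi.
by exists 0 => t _; rewrite cosN subrr normr0 mul0r.
Qed.

Lemma circle_lipschitz_sin : circle_lipschitz (@sin R).
Proof.
split; first exact: continuous_sin.
  by move=> t; rewrite mulr_natl sinD2pi.
exists (2 * 1); apply: (odd_part_bound (pi_ge0 R) (@is_derive_sin R)) => t _.
exact: cos_max.
Qed.

Lemma odd_transformD f h : circle_lipschitz f -> circle_lipschitz h ->
  odd_transform (fun t => f t + h t) = odd_transform f + odd_transform h.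
Proof.
move=> [cf pf lf] [ch ph lh]; rewrite /odd_transform -RintegralD//.
- by apply: eq_Rintegral => t _; ring.
- exact: half_cot_odd_part_integrable.
- exact: half_cot_odd_part_integrable.
Qed.

Lemma odd_transformZ k f : circle_lipschitz f ->
  odd_transform (fun t => k * f t) = k * odd_transform f.
Proof.
move=> [cf pf lf]; rewrite /odd_transform -RintegralZl//.
- by apply: eq_Rintegral => t _; ring.
- exact: half_cot_odd_part_integrable.
Qed.

Lemma circle_sum_integrable f : circle_lipschitz f ->
  mu.-integrable `[0, pi] (EFin \o (fun t => f t + f (- t))).
Proof.
move=> [cf _ _]; apply: continuous_compact_integrable; first exact: segment_compact.
apply: continuous_subspaceT => t; apply: cvgD; first exact: cf.
by apply: (@continuous_comp _ _ _ -%R f); [exact: opp_continuous|exact: cf].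
Qed.

Lemma circle_sumD f h : circle_lipschitz f -> circle_lipschitz h ->
  circle_sum (fun t => f t + h t) = circle_sum f + circle_sum h.
Proof.
move=> lf lh; rewrite /circle_sum -RintegralD//.
- by apply: eq_Rintegral => t _; ring.
- exact: circle_sum_integrable.
- exact: circle_sum_integrable.
Qed.

Lemma circle_sumZ k f : circle_lipschitz f ->
  circle_sum (fun t => k * f t) = k * circle_sum f.
Proof.
move=> lf; rewrite /circle_sum -RintegralZl//.
- by apply: eq_Rintegral => t _; ring.
- exact: circle_sum_integrable.
Qed.

Lemma half_cot_sin (t : R) : sin (t / 2) != 0 -> half_cot t * sin t = 1 + cos t.
Proof.
move=> s0; have E : t = t / 2 + t / 2 by field.
rewrite /half_cot {3 4}E sinD cosD.
have := cos2Dsin2 (t / 2).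
move: s0; set c := cos (t / 2); set s := sin (t / 2) => s0.
move=> cs; have -> : 1 + (c * c - s * s) = 2 * (c * c) by lra.
by field.
Qed.

Lemma half_cot_cos (t : R) : half_cot t * (cos t - 1) = - sin t.
Proof.
have E : t = t / 2 + t / 2 by field.
rewrite /half_cot {3 4}E sinD cosD.
have := cos2Dsin2 (t / 2).
set c := cos (t / 2); set s := sin (t / 2).
move=> cs; have -> : c * c - s * s - 1 = - (2 * (s * s)) by lra.
have [->|s0] := eqVneq s 0; first by rewrite !(mulr0, mul0r, addr0, oppr0).
by field.
Qed.

(** Commuting the kernel with cos t p + sin t q leaves the factors
    half_cot t (cos t - 1) = - sin t and half_cot t sin t = 1 + cos t, in which
    the singularity has cancelled. *)
Lemma odd_transform_commutator (f : R -> R) (p q : R) : circle_lipschitz f ->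
  odd_transform (fun t => (cos t * p + sin t * q) * f t) - p * odd_transform f =
  q * circle_sum f + circle_sum (fun t => (cos t * q - sin t * p) * f t).
Proof.
move=> lf; have lpq (a b : R) : circle_lipschitz (fun t => cos t * a + sin t * b).
  exact: (circle_lipschitzD
    (circle_lipschitzM circle_lipschitz_cos (circle_lipschitz_cst a))
    (circle_lipschitzM circle_lipschitz_sin (circle_lipschitz_cst b))).
have l1 := circle_lipschitzM (lpq p q) lf.
have l2 : circle_lipschitz (fun t => (cos t * q - sin t * p) * f t).
  have := circle_lipschitzM (lpq q (- p)) lf.
  by under eq_fun do rewrite mulrN.
rewrite -mulN1r -(odd_transformZ p lf).
rewrite -(odd_transformZ (-1) (circle_lipschitzZ p lf)) -(circle_sumZ q lf).
rewrite -(odd_transformD l1 (circle_lipschitzZ (-1) (circle_lipschitzZ p lf))).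
rewrite -(circle_sumD (circle_lipschitzZ q lf) l2).
have l3 := circle_lipschitzD l1 (circle_lipschitzZ (-1) (circle_lipschitzZ p lf)).
have l4 := circle_lipschitzD (circle_lipschitzZ q lf) l2.
have i3 : mu.-integrable `[0, pi] (EFin \o (fun t =>
  half_cot t * (((cos t * p + sin t * q) * f t + -1 * (p * f t))
   - ((cos (- t) * p + sin (- t) * q) * f (- t) + -1 * (p * f (- t)))))).
  by case: l3; exact: half_cot_odd_part_integrable.
have i4 := circle_sum_integrable l4.
(* the integrands differ at t = 0, where half_cot takes the value 1 / 0 = 0 *)
rewrite /odd_transform /circle_sum -!Rintegral_itv_obnd_cbnd.
- apply: eq_Rintegral => t /set_mem; rewrite /= in_itv/= => /andP[t0 tpi].
  have s0 : sin (t / 2) != 0.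
    by rewrite lt0r_neq0// sin_gt0_pi//; have := pi_gt0 R; lra.
  have e1 := half_cot_sin s0; have e2 := half_cot_cos t.
  rewrite cosN sinN.
  transitivity (half_cot t * (cos t - 1) * p * (f t - f (- t))
    + half_cot t * sin t * q * (f t + f (- t))); first by ring.
  by rewrite e1 e2; ring.
- by apply: integrableS i4 => //; exact: subset_itv_oc_cc.
- by apply: integrableS i3 => //; exact: subset_itv_oc_cc.
Qed.

End CircleOperators.

(** * Derivatives of the transforms at the centre of the preferred chart *)

Section Commutator.
Variables (R : realType) (M : oriented_surface R) (g : riemannian_metric M).
Variables (u : bundle_fun M) (u_smooth : smooth_bundle_fun g u).
Variables (x : M) (xi : 'rV[R]_2) (xi_unit : riem_norm g x xi = 1).
Local Notation rV := 'rV[R]_2.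
Local Notation mu := (@lebesgue_measure R).
Local Notation c := (chart_at x).
Local Notation y0 := (chart (chart_at x) x).
Local Notation G := (metric_coef g (chart_at x)).
Local Notation U := (local_ext g u (chart_at x)).
Implicit Types (a b w : rV) (s t : R).

Lemma chart_img_center : chart_img c y0.
Proof. by exists x => //; exact: chart_at_dom. Qed.

Lemma chart_inv_center : chart_inv c y0 = x.
Proof. by apply: chartK; exact: chart_at_dom. Qed.

(** Near the centre the transition map of the preferred chart to itself is the
    identity. *)
Lemma tangent_of_center w : tangent_of c y0 w = w.
Proof.
rewrite /tangent_of chart_inv_center -deriveE; last first.
  have h := @transition_smooth _ M c c [::] y0; apply: h.
  by exists x => //; split; exact: chart_at_dom.
have e : \forall y \near y0, (chart c \o chart_inv c) y = id y.
  have : nbhs y0 (chart_img c).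
    by apply: open_nbhs_nbhs; split; [exact: img_open|exact: chart_img_center].
  by apply: filterS => y [z cz <-] /=; rewrite chartK.
by rewrite (near_eq_derive _ e) derive_id.
Qed.

Lemma metric_coef_center : G y0 = g x.
Proof.
apply/matrixP => j k; rewrite !mxE !tangent_of_center chart_inv_center.
by rewrite riem_innerE /gram_inner -rowE trmx_delta -colE !mxE.
Qed.

Section Line.
Variables (w a b : rV).
Hypothesis w0 : w != 0.

Let D_open : open (chart_img c) := @img_open _ M c.

Let G_smooth : smooth_on (chart_img c) G := @gram_smooth _ _ g c.

Let U_smooth : smooth_on [set p | chart_img c p.1 /\ p.2 != 0] U := @u_smooth c.

Let dom := line_in_domain D_open a b chart_img_center w0.

Let Gs : forall y, chart_img c y -> spd (G y).
Proof. by move=> y; exact: spd_metric_coef. Qed.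

(** Derivative at the rotated vector when the base point and the unrotated
    vector move in the direction (a, b) and the angle t is kept. *)
Definition fibre_derive t :=
  'D_(rot_velocity G y0 w a b t 0) U (rot_point G y0 w a b t 0).

Lemma circle_lipschitz_fibre_derive : circle_lipschitz fibre_derive.
Proof.
have [d d0 hd] := dom.
exact: (circle_lipschitz_rot_velocity D_open G_smooth Gs U_smooth d0 hd).
Qed.

(** Near (y0, w) the extension of Hu is an integral over rotations, which is
    differentiated under the integral sign. *)
Lemma local_ext_hilbert_derive :
  'D_(a, b) (local_ext g (hilbert g u) c) (y0, w)
  = (2 * pi)^-1 * odd_transform fibre_derive.
Proof.
have [d d0 hd] := dom; rewrite derive_along_line.
have od := is_derive_odd_transform D_open G_smooth Gs U_smooth d0 hd.
have [_ odE] := is_deriveZ (2 * pi)^-1 od.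
apply: etrans odE; apply: near_eq_derive; apply/nbhs_ballP; exists (d / 2).
  by rewrite /= divr_gt0.
move=> s; rewrite -ball_normE /= sub0r normrN => /ltW sd.
have [D1 D2] := hd s ltac:(lra).
have [cW pW lW] := circle_lipschitz_rot_point D_open G_smooth Gs U_smooth d0 hd sd.
exact: (local_ext_hilbert D1 D2 cW lW).
Qed.

Lemma local_ext_average_derive :
  'D_(a, b) (local_ext g (pullback (fibre_average g u)) c) (y0, w)
  = (2 * pi)^-1 * circle_sum fibre_derive.
Proof.
have [d d0 hd] := dom; rewrite derive_along_line.
have od := is_derive_circle_sum D_open G_smooth Gs U_smooth d0 hd.
have [_ odE] := is_deriveZ (2 * pi)^-1 od.
apply: etrans odE; apply: near_eq_derive; apply/nbhs_ballP; exists (d / 2).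
  by rewrite /= divr_gt0.
move=> s; rewrite -ball_normE /= sub0r normrN => /ltW sd.
have [D1 D2] := hd s ltac:(lra).
have [cW pW lW] := circle_lipschitz_rot_point D_open G_smooth Gs U_smooth d0 hd sd.
exact: (local_ext_average D1 D2 cW).
Qed.

End Line.
End Commutator.

(** * Rotations preserve horizontal vectors *)

Section NablaCommutes.
Variables (R : realType) (M : oriented_surface R) (g : riemannian_metric M).
Variables (u : bundle_fun M) (u_smooth : smooth_bundle_fun g u).
Variables (x : M) (xi : 'rV[R]_2) (xi_unit : riem_norm g x xi = 1).
Local Notation rV := 'rV[R]_2.
Local Notation c := (chart_at x).
Local Notation y0 := (chart (chart_at x) x).
Local Notation G := (metric_coef g (chart_at x)).
Local Notation U := (local_ext g u (chart_at x)).
Local Notation d0 := (delta_mx 0 ord0 : 'rV[R]_2).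
Local Notation d1 := (delta_mx 0 ord_max : 'rV[R]_2).
Implicit Types (j : 'I_2) (s t : R).

Lemma xi_neq0 : xi != 0.
Proof.
apply/eqP => xi0; have := xi_unit.
rewrite xi0 /riem_norm riem_innerE /gram_inner !mul0mx mxE sqrtr0 => /eqP.
by rewrite eq_sym oner_eq0.
Qed.

Lemma derive_metric_coef (l a b : 'I_2) :
  ('D_(delta_mx 0 l) G y0) a b = 'D_(delta_mx 0 l) (fun z => G z a b) y0.
Proof.
rewrite derive_mx ?mxE//; apply: diff_derivable.
exact: (smooth_on_differentiable (@gram_smooth _ _ g c) (chart_img_center x)).
Qed.

Lemma christoffelE i j k : christoffel g c y0 i j k =
  levi_civita (g x) (fun l => 'D_(delta_mx 0 l) G y0) i j k.
Proof.
rewrite /christoffel /levi_civita metric_coef_center; congr (_ * _).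
by apply: eq_bigr => l _; rewrite -!derive_metric_coef.
Qed.

Lemma derive_metric_coef_sym (l : 'I_2) :
  ('D_(delta_mx 0 l) G y0)^T = 'D_(delta_mx 0 l) G y0.
Proof.
have symG i k : (fun z => G z i k) = (fun z => G z k i).
  apply/funext => z; rewrite /metric_coef [LHS]mxE [RHS]mxE !riem_innerE.
  exact/gram_innerC/spd_gram.
by apply/matrixP => i k; rewrite [LHS]mxE (derive_metric_coef l k i)
  (derive_metric_coef l i k) symG.
Qed.

Lemma nablaE (v : bundle_fun M) j : nabla g v x xi j =
  'D_(delta_mx 0 j, 0) (local_ext g v c) (y0, xi)
  - \sum_i (\sum_k christoffel g c y0 i j k * xi 0 k)
     * 'D_(0, delta_mx 0 i) (local_ext g v c) (y0, xi).
Proof. by rewrite /nabla; congr (_ - _); apply: eq_bigr => i _; rewrite mulr_suml. Qed.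

(** Differentiating horizontally at the rotated vector is the same as moving xi
    horizontally, in the direction (e_j, - Gamma_j xi), and letting the
    rotation carry this motion along: the quarter turn is parallel. *)
Lemma nabla_rot_by j t : nabla g u x (rot_by (g x) t xi) j =
  fibre_derive g u x xi (delta_mx 0 j) 0 t
  - \sum_i (\sum_k christoffel g c y0 i j k * xi 0 k)
     * fibre_derive g u x xi 0 (delta_mx 0 i) t.
Proof.
have sG := spd_gram g x.
pose r := rot_by (g x) t xi.
have dU : differentiable U (y0, r).
  apply: (smooth_on_differentiable (@u_smooth c)); split.
    exact: chart_img_center.
  by apply: rot_by_neq0 => //; exact: xi_neq0.
pose B i := 'D_(0, delta_mx 0 i) U (y0, r).
have fdE a b : fibre_derive g u x xi a b t = 'D_(a, 0) U (y0, r) +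
    ((cos t *: b + sin t *: drot90 (g x) ('D_a G y0) xi b) 0 ord0 * B ord0
    + (cos t *: b + sin t *: drot90 (g x) ('D_a G y0) xi b) 0 ord_max * B ord_max).
  rewrite /fibre_derive /rot_point /rot_velocity !scale0r !addr0 metric_coef_center.
  by rewrite (derive_split a _ dU) (derive_vertical _ dU).
have fdE0 i : fibre_derive g u x xi 0 (delta_mx 0 i) t =
    (cos t *: delta_mx 0 i + sin t *: rot90 (g x) (delta_mx 0 i)) 0 ord0 * B ord0
    + (cos t *: delta_mx 0 i + sin t *: rot90 (g x) (delta_mx 0 i)) 0 ord_max * B ord_max.
  rewrite fdE (derive0 G y0) drot90_cst//.
  by rewrite -[(0, 0)]/(0 : rV * rV) (derive0 U) add0r.
rewrite fdE (eq_bigr _ (fun i _ => congr1 _ (fdE0 i))).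
pose Gam i k := christoffel g c y0 i j k.
have GamE : Gam = fun i k =>
    levi_civita (g x) (fun l => 'D_(delta_mx 0 l) G y0) i j k.
  by apply/funext => i; apply/funext => k; exact: christoffelE.
have key m : drot90 (g x) ('D_(delta_mx 0 j) G y0) xi 0 0 m
    + \sum_k Gam m k * rot90 (g x) xi 0 k =
    \sum_i (\sum_k Gam i k * xi 0 k) * rot90 (g x) (delta_mx 0 i) 0 m.
  by rewrite GamE; exact: (levi_civita_rot90 xi j m sG derive_metric_coef_sym).
exact: (turn_connection ('D_(delta_mx 0 j, 0) U (y0, r)) (cos t) (sin t) B key).
Qed.

End NablaCommutes.

(** * The commutator *)

Section Assembly.
Variables (R : realType) (M : oriented_surface R) (g : riemannian_metric M).
Variables (u : bundle_fun M) (u_smooth : smooth_bundle_fun g u).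
Variables (x : M) (xi : 'rV[R]_2) (xi_unit : riem_norm g x xi = 1).
Implicit Types (j : 'I_2) (s t : R).

Definition nabla_rot j t := nabla g u x (rot_by (g x) t xi) j.

Let vertical_coef i j :=
  - \sum_k christoffel g (chart_at x) (chart (chart_at x) x) i j k * xi 0 k.
Let horizontal j := fibre_derive g u x xi (delta_mx 0 j) 0.
Let vertical i := fibre_derive g u x xi 0 (delta_mx 0 i).

Let nabla_rotE j : nabla_rot j = fun t => horizontal j t
  + (vertical_coef ord0 j * vertical ord0 t
     + vertical_coef ord_max j * vertical ord_max t).
Proof.
apply/funext => t; rewrite /nabla_rot nabla_rot_by// sum_ord2.
have regroup (A a b V W : R) : A - (a * V + b * W) = A + (- a * V + - b * W).
  by ring.
exact: regroup.
Qed.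

Let lip_h j : circle_lipschitz (horizontal j).
Proof. by apply: circle_lipschitz_fibre_derive => //; exact: xi_neq0 xi_unit. Qed.

Let lip_v i : circle_lipschitz (vertical i).
Proof. by apply: circle_lipschitz_fibre_derive => //; exact: xi_neq0 xi_unit. Qed.

Let lip_sum j : circle_lipschitz (fun t =>
  vertical_coef ord0 j * vertical ord0 t
     + vertical_coef ord_max j * vertical ord_max t).
Proof.
exact: (circle_lipschitzD (circle_lipschitzZ _ (lip_v ord0))
  (circle_lipschitzZ _ (lip_v ord_max))).
Qed.

Lemma circle_lipschitz_nabla j : circle_lipschitz (nabla_rot j).
Proof. by rewrite nabla_rotE; exact: (circle_lipschitzD (lip_h j) (lip_sum j)). Qed.

(** nabla_j is a fixed combination of the derivatives in the directions
    (e_j, 0) and (0, e_i); it passes under the integral by linearity and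
    becomes nabla_j at the rotated vectors. *)
Lemma nabla_hilbert j : nabla g (hilbert g u) x xi j =
  (2 * pi)^-1 * odd_transform (nabla_rot j).
Proof.
have xi0 := xi_neq0 xi_unit.
rewrite nablaE sum_ord2 !local_ext_hilbert_derive// nabla_rotE.
have E := etrans (odd_transformD (lip_h j) (lip_sum j)) (congr1 (+%R _)
  (etrans (odd_transformD (circle_lipschitzZ _ (lip_v ord0))
    (circle_lipschitzZ _ (lip_v ord_max)))
    (congr2 +%R (odd_transformZ (vertical_coef ord0 j) (lip_v ord0))
      (odd_transformZ (vertical_coef ord_max j) (lip_v ord_max))))).
apply: etrans (congr1 ( *%R (2 * pi)^-1) (esym E)).
have regroup (k A a b V W : R) :
  k * A - (a * (k * V) + b * (k * W)) = k * (A + (- a * V + - b * W)) by ring.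
exact: regroup.
Qed.

Lemma nabla_average j : nabla g (pullback (fibre_average g u)) x xi j =
  (2 * pi)^-1 * circle_sum (nabla_rot j).
Proof.
have xi0 := xi_neq0 xi_unit.
rewrite nablaE sum_ord2 !local_ext_average_derive// nabla_rotE.
have E := etrans (circle_sumD (lip_h j) (lip_sum j)) (congr1 (+%R _)
  (etrans (circle_sumD (circle_lipschitzZ _ (lip_v ord0))
    (circle_lipschitzZ _ (lip_v ord_max)))
    (congr2 +%R (circle_sumZ (vertical_coef ord0 j) (lip_v ord0))
      (circle_sumZ (vertical_coef ord_max j) (lip_v ord_max))))).
apply: etrans (congr1 ( *%R (2 * pi)^-1) (esym E)).
have regroup (k A a b V W : R) :
  k * A - (a * (k * V) + b * (k * W)) = k * (A + (- a * V + - b * W)) by ring.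
exact: regroup.
Qed.

End Assembly.

Theorem theorem1p5 (R : realType) (M : oriented_surface R)
    (g : riemannian_metric M) (u : bundle_fun M)
    (u_smooth : smooth_bundle_fun g u)
    (x : M) (xi : 'rV[R]_2) (xi_unit : riem_norm g x xi = 1) :
  hilbert g (geodesic_field g u) x xi - geodesic_field g (hilbert g u) x xi
  = geodesic_field_perp g (pullback (fibre_average g u)) x xi
    + fibre_average g (geodesic_field_perp g u) x.
Proof.
have sG := spd_gram g x.
pose N := nabla_rot g u x xi.
have lN j : circle_lipschitz (N j) by exact: circle_lipschitz_nabla.
pose p j := xi 0 j; pose q j := perp g x xi 0 j.
have lturn a b : circle_lipschitz (fun t : R => cos t * a + sin t * b).
  exact: (circle_lipschitzD
    (circle_lipschitzM (@circle_lipschitz_cos R) (circle_lipschitz_cst a))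
    (circle_lipschitzM (@circle_lipschitz_sin R) (circle_lipschitz_cst b))).
have lp j : circle_lipschitz (fun t => (cos t * p j + sin t * q j) * N j t).
  exact: (circle_lipschitzM (lturn _ _) (lN j)).
have lq j : circle_lipschitz (fun t => (cos t * q j - sin t * p j) * N j t).
  have := circle_lipschitzM (lturn (q j) (- p j)) (lN j).
  by under eq_fun do rewrite mulrN.
have along : (fun t => geodesic_field g u x (rot_by (g x) t xi)) =
    fun t => (cos t * p ord0 + sin t * q ord0) * N ord0 t
      + (cos t * p ord_max + sin t * q ord_max) * N ord_max t.
  apply/funext => t; rewrite /geodesic_field sum_ord2.
  have turn j : rot_by (g x) t xi 0 j = cos t * p j + sin t * q j.
    by rewrite /rot_by [LHS]mxE; congr (_ + _); exact: mxE.
  by rewrite (turn ord0) (turn ord_max).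
have across : (fun t => geodesic_field_perp g u x (rot_by (g x) t xi)) =
    fun t => (cos t * q ord0 - sin t * p ord0) * N ord0 t
      + (cos t * q ord_max - sin t * p ord_max) * N ord_max t.
  apply/funext => t; rewrite /geodesic_field_perp sum_ord2.
  have turn j : perp g x (rot_by (g x) t xi) 0 j = cos t * q j - sin t * p j.
    rewrite (rot90_rot_by t xi sG : perp g x _ = _) [LHS]mxE.
    by congr (_ + _); rewrite mxE // mxE.
  by rewrite (turn ord0) (turn ord_max).
have lalong := circle_lipschitzD (lp ord0) (lp ord_max).
have lacross := circle_lipschitzD (lq ord0) (lq ord_max).
have -> : hilbert g (geodesic_field g u) x xi =
   (2 * pi)^-1 * odd_transform (fun t => geodesic_field g u x (rot_by (g x) t xi)).
  have [cA _ lA] : circle_lipschitz (fun t =>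
    geodesic_field g u x (rot_by (g x) t xi)) by rewrite along.
  exact: (hilbertE xi_unit cA lA).
have -> : fibre_average g (geodesic_field_perp g u) x =
   (2 * pi)^-1 * circle_sum (fun t => geodesic_field_perp g u x (rot_by (g x) t xi)).
  have [cA _ _] : circle_lipschitz (fun t =>
    geodesic_field_perp g u x (rot_by (g x) t xi)) by rewrite across.
  exact: (fibre_averageE xi_unit cA).
rewrite along across (odd_transformD (lp ord0) (lp ord_max)).
rewrite (circle_sumD (lq ord0) (lq ord_max)).
have factor (k a b A B : R) : a * (k * A) + b * (k * B) = k * (a * A + b * B).
  by ring.
have -> : geodesic_field g (hilbert g u) x xi = (2 * pi)^-1 *
    (p ord0 * odd_transform (N ord0) + p ord_max * odd_transform (N ord_max)).
  by rewrite /geodesic_field sum_ord2 !nabla_hilbert//; exact: factor.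
have -> : geodesic_field_perp g (pullback (fibre_average g u)) x xi = (2 * pi)^-1 *
    (q ord0 * circle_sum (N ord0) + q ord_max * circle_sum (N ord_max)).
  by rewrite /geodesic_field_perp sum_ord2 !nabla_average//; exact: factor.
have add_up (A A' B B' C C' D D' : R) : A - B = C + D -> A' - B' = C' + D' ->
  A + A' - (B + B') = C + C' + (D + D').
  by move=> e e'; rewrite opprD addrACA e e' addrACA.
rewrite -mulrBr -mulrDr; congr (_ * _).
exact: (add_up _ _ _ _ _ _ _ _
  (odd_transform_commutator (p ord0) (q ord0) (lN ord0))
  (odd_transform_commutator (p ord_max) (q ord_max) (lN ord_max))).
Qed.
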